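(* Suppose that edges are subsequently removed uniformly at random (without replacement) from $\overline{CM}_n(\mathbf d)$, and let $T_{n,\mathbf d}$ be the smallest number of edges that need to be removed for the network to be disconnected. Then, as $n\to\infty$, $$m^{-1/2}\,T_{n,\mathbf d}\ \xrightarrow{d}\ T(D),$$ where $T(D)$ has a Rayleigh distribution with density function $$f_{T(D)}(x)=\frac{4p_2x}{d-2p_2}\,e^{-\frac{2x^2p_2}{d-2p_2}},\qquad x\ge0.$$
   Context: For each $n$ let $\mathbf d=(d_1,\dots,d_n)$ be a degree sequence (depending on $n$) of nonnegative integers with even sum, and let $m=\frac12\sum_{i=1}^n d_i$. $CM_n(\mathbf d)$ is the configuration model: the random multigraph on $[n]$ obtained by attaching $d_v$ half-edges to each vertex $v$ and pairing all half-edges uniformly at random; it has $m$ edges. $\overline{CM}_n(\mathbf d)$ is $CM_n(\mathbf d)$ conditioned to be connected. Let $n_i$ be the number of vertices of degree $i$ and $D_n$ the degree of a uniformly chosen vertex. Standing assumptions: $D_n$ converges in distribution to a random variable $D$; $n_0=n_1=0$; $p_2:=\lim_{n\to\infty} n_2/n\in(0,1)$; for some $\varepsilon>0$, $n_j=0$ for all $j\ge n^{1/4-\varepsilon}$; $d:=\lim_{n\to\infty}\mathbb E[D_n]<\infty$. Vertices are never removed, so an isolated vertex is a component. *)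

(* Defs.v *)
From mathcomp Require Import all_boot all_order all_algebra.
From mathcomp Require Import all_classical all_reals all_analysis.

Set Implicit Arguments.
Unset Strict Implicit.
Unset Printing Implicit Defensive.

Import Order.TTheory GRing.Theory Num.Theory.
Import numFieldNormedType.Exports.

Local Open Scope ring_scope.

Section ConfigurationModel.
Variables (n : nat) (d : 'I_n -> nat).

Definition degree_sum : nat := (\sum_(v < n) d v)%N.

Definition num_edges : nat := (degree_sum./2)%N.

Definition num_deg (i : nat) : nat := #|[set v | d v == i]|.

(* The half-edges attached to [v] are the pairs with first component [v]. *)
Definition half_edge : finType := {v : 'I_n & 'I_(d v)}.

(* An edge of the multigraph is a set of two half-edges, so that parallel edges
   and loops are kept apart; a pairing is the set of its edges. *)
Definition pairings : {set {set {set half_edge}}} :=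
  [set M | finset.partition M [set: half_edge] && [forall e in M, #|e| == 2%N]].

Definition adjacent_in (E : {set {set half_edge}}) : rel 'I_n := fun u v =>
  [exists h : half_edge, exists h' : half_edge,
    [&& tag h == u, tag h' == v & [set h; h'] \in E]].

Definition connected_graph (E : {set {set half_edge}}) : bool :=
  [forall u, forall v, connect (adjacent_in E) u v].

(* Least [k] such that deleting the first [k] edges of [s] disconnects the
   graph with edge list [s].  Deleting all the edges disconnects any graph with
   at least two vertices; for [n <= 1] there is no such [k] and the value is
   [(size s).+1]. *)
Definition disconnection_time (s : seq {set half_edge}) : nat :=
  find (fun k => ~~ connected_graph [set:: drop k s]) (iota 0 (size s).+1).

Variable R : realType.

Definition CM (M : {set {set half_edge}}) : R :=
  (M \in pairings)%:R / #|pairings|%:R.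

Definition CM_connected (M : {set {set half_edge}}) : R :=
  (if connected_graph M then CM M else 0)
  / \sum_(M' | connected_graph M') CM M'.

(* The probability that [T] satisfies [A]: the multigraph is drawn from
   [CM_connected] and, given the multigraph, the order in which its edges are
   removed is uniform among all orderings of its edges. *)
Definition prob_T (A : pred nat) : R :=
  \sum_M CM_connected M *
    ((\sum_(s <- permutations (enum M)) (A (disconnection_time s))%:R)
     / (size (permutations (enum M)))%:R).

Definition prob_D (A : pred nat) : R := #|[set v | A (d v)]|%:R / n%:R.

Definition mean_D : R := degree_sum%:R / n%:R.

End ConfigurationModel.

Section Laws.
Local Open Scope classical_set_scope.
Variable R : realType.

(* The distribution functions [F n] converge to that of the law [mu] at each
   point where the latter is continuous. *)
Definition cvg_in_distribution (F : nat -> R -> R)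
    (mu : probability (measurableTypeR R) R) : Prop :=
  forall x : R, {for x, continuous (fun y : R => mu `]-oo, y])} ->
    (F n x)%:E @[n --> \oo] --> mu `]-oo, x].

Definition has_density (mu : probability (measurableTypeR R) R) (f : R -> R)
    : Prop :=
  forall A : set (measurableTypeR R), measurable A ->
    mu A = (\int[lebesgue_measure]_(x in A) (f x)%:E)%E.

End Laws.

(* Main.v *)
Require Import Defs.
From HB Require Import structures.
From mathcomp Require Import all_boot all_order all_algebra perm.
From mathcomp Require Import all_classical all_reals all_analysis.
From mathcomp Require Import measurable_realfun zify ring lra.

(** Consider one degree sequence with all degrees at least 2, with [m] edges
    and [n2] vertices of degree 2, and put [m' = m - n2]. Count the pairings of
    the half-edges together with [k] removed edges for which the kept edges
    connect all vertices ([survivals]). Given that the graph is connected, the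
    probability that it survives [k] removals is the ratio of this number to
    the number of connected pairings times the binomial coefficient of [m] and
    [k] ([prob_T_survivals]).

    A vertex of degree 2 can be suppressed exactly. In a surviving
    configuration it keeps at least one of its two edges, and merging these
    edges gives a surviving configuration with one vertex less. Conversely the
    vertex can be inserted in 2 ways on a kept edge and in 4 ways on a removed
    one, since one then chooses which half stays removed. Hence it multiplies
    the count by the number of half-edges of the smaller graph plus [2 k]
    ([survivals_contract]). After suppressing all vertices of degree 2, only
    the kernel remains: the vertices of degree at least 3, with [m'] edges. The
    factors collected on the way, divided by those for [k = 0], are the product
    over [i < k] of (m + i)(m' - i) / ((m' + i)(m - i)) ([no_repeat_probE]).
    This is the probability that no two of the [k] edges lie on the same path
    of vertices of degree 2. Its factors are 1 - 2 i n2 / ((m' + i)(m - i)), so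
    for [k] close to x sqrt m it tends to the limit of exp(- x^2 n2 / m'), and
    n2 / m' tends to 2 p2 / (dbar - 2 p2). This is the tail of the Rayleigh law.

    It remains to see that the kernel survives of order sqrt m removals with
    high probability ([kernel_survival]). If it does not, some set of vertices
    carrying [s <= m'] half-edges is not left by any kept edge. For a given set
    this probability depends on [s] only, because the half-edges are
    exchangeable ([num_saturated_card]); averaging over all sets of [s]
    half-edges, it is the number of unions of kept edges and removed half-edges
    of total size [s], divided by the binomial coefficient B of [2 m'] and [s].
    Up to the effect of the removed edges, this number is about the square root
    of B. As degrees are at least 3, at most about the cube root of B sets of
    vertices have [s] half-edges. So the expected number of bad sets is about
    the power -1/6 of B, which is summable in [s] and of order the power -1/6
    of [m'] in total ([small_cut_term], [cut_estimate]). *)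

Set Implicit Arguments.
Unset Strict Implicit.
Unset Printing Implicit Defensive.

Import Order.TTheory GRing.Theory Num.Theory.
Import numFieldNormedType.Exports.

(** * Pairings of half-edges, with some edges removed *)

Section Matchings.
Variable H : finType.
Implicit Types (a x : H) (e X Y : {set H}) (M S F : {set {set H}})
  (p : {set {set H}} * {set {set H}}).

Definition matchings X : {set {set {set H}}} :=
  [set M | finset.partition M X && [forall e in M, #|e| == 2]].

Lemma matchingP M X :
  reflect [/\ finset.cover M = X, finset.trivIset M & {in M, forall e, #|e| = 2}]
          (M \in matchings X).
Proof.
rewrite inE; apply: (iffP andP).
  by case=> /and3P[/eqP cM tM _] /forall_inP h; split=> // e /h /eqP.
case=> cM tM h; split; last by apply/forall_inP => e /h ->.
apply/and3P; split=> //; first exact/eqP.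
by apply/negP=> /h; rewrite cards0.
Qed.

Lemma matching_edge M X e : M \in matchings X -> e \in M -> e \subset X.
Proof. by case/matchingP=> <- _ _ eM; apply: finset.bigcup_max eM _. Qed.

Lemma card_matching M X : M \in matchings X -> #|X| = (#|M| * 2)%N.
Proof.
rewrite inE => /andP[pM /forall_inP h].
by apply: card_uniform_partition pM => e /h /eqP.
Qed.

Lemma matchingU1 X e M : e \subset X -> #|e| = 2 -> e \notin M ->
  (e |: M \in matchings X) = (M \in matchings (X :\: e)).
Proof.
move=> eX e2 eM; apply/idP/idP.
  move=> /[dup] eMX /matchingP[cM tM h].
  have dis e' : e' \in M -> [disjoint e & e'].
    move=> e'M; apply: (finset.trivIsetP tM); rewrite ?setU11 ?setU1r //.
    by apply: contraNneq eM => ->.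
  apply/matchingP; split; last by move=> e' e'M; apply: h; rewrite setU1r.
    rewrite -cM /finset.cover finset.bigcup_setU finset.big_set1 finset.setDUl finset.setDv finset.set0U.
    apply/esym/finset.setDidPl; rewrite disjoint_sym.
    by apply/bigcup_disjointP => e' /dis.
  by apply: finset.trivIsetS tM; exact: finset.subsetUr.
move=> /[dup] MX /matchingP[cM tM h]; apply/matchingP; split.
- rewrite /finset.cover finset.bigcup_setU finset.big_set1 -/(finset.cover M) cM.
  by rewrite -{2}(finset.setID X e) (finset.setIidPr eX).
- have [] // := @finset.trivIsetU1 _ e M _ tM _.
    move=> e' e'M; rewrite disjoint_sym.
    by have /subsetDP[] := matching_edge MX e'M.
  by apply/negP=> /h; rewrite cards0.
- by move=> e' /setU1P[->//|/h].
Qed.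

Lemma partner_unique X M a : M \in matchings X -> a \in X ->
  \sum_(x in X :\ a) ([set a; x] \in M) = 1%N.
Proof.
move=> MX aX; case/matchingP: (MX) => cM tM h.
have pM : finset.pblock M a \in M by rewrite finset.pblock_mem ?cM.
have ap : a \in finset.pblock M a by rewrite finset.mem_pblock cM.
have /eqP/cards2P[u [v [uv Epb]]] := h _ pM.
have [x xa Ex] : exists2 x, x != a & finset.pblock M a = [set a; x].
  move: ap; rewrite Epb !inE => /orP[]/eqP ->; first by exists v; rewrite // eq_sym.
  by exists u; rewrite // finset.setUC.
have xX : x \in X :\ a.
  by rewrite !inE xa (fintype.subsetP (matching_edge MX pM)) // Ex set22.
rewrite (bigD1 x) //= -Ex pM big1 // => y /andP[/setD1P[ya yX] yx].
case: (boolP (_ \in M)) => // yM; case/negP: yx.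
have := finset.def_pblock tM yM (set21 _ _); rewrite Ex => /setP/(_ y).
by rewrite !inE eqxx orbT (negPf ya) /= => /eqP ->.
Qed.

Lemma disjoint_setU1 (T : finType) (x : T) (A B : {set T}) :
  [disjoint x |: A & B] = (x \notin B) && [disjoint A & B].
Proof. by rewrite -disjointU1; apply: eq_disjoint => y; rewrite !inE. Qed.

(** A pairing some of whose edges are removed: [p.1] holds the removed edges
    and [p.2] the kept ones. Two disjoint sets, rather than a pairing and a
    subset of it, make the recursion below symmetric in removed and kept
    edges. *)
Definition marked X : {set {set {set H}} * {set {set H}}} :=
  [set p | (p.1 :|: p.2 \in matchings X) && [disjoint p.1 & p.2]].

Lemma markedP p X : reflect (p.1 :|: p.2 \in matchings X /\ [disjoint p.1 & p.2]) (p \in marked X).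
Proof. by rewrite [p \in marked X]finset.in_set; apply: andP. Qed.

Lemma marked_edge p X e : p \in marked X -> (e \in p.1) || (e \in p.2) -> e \subset X /\ #|e| = 2.
Proof.
move=> /markedP[pX _] ep; have ep' : e \in p.1 :|: p.2 by rewrite inE.
by split; [exact: matching_edge pX ep'|case/matchingP: pX => _ _; apply].
Qed.

Lemma marked_fresh p X e x : p \in marked X -> x \in e -> x \notin X ->
  (e \in p.1 = false) * (e \in p.2 = false).
Proof.
move=> pX xe xX; split; apply/negP => ep; case/negP: xX.
  by have [/fintype.subsetP-> //] := marked_edge pX (introT orP (or_introl ep)).
by have [/fintype.subsetP-> //] := marked_edge pX (introT orP (or_intror ep)).
Qed.

Lemma markedU1l X e p : e \subset X -> #|e| = 2 -> e \notin p.1 -> e \notin p.2 ->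
  ((e |: p.1, p.2) \in marked X) = (p \in marked (X :\: e)).
Proof.
move=> eX e2 e1 e2'; rewrite ![_ \in marked _]finset.in_set /= -finset.setUA matchingU1 ?inE ?(negPf e1) //.
by rewrite disjoint_setU1 e2'.
Qed.

Lemma markedU1r X e p : e \subset X -> #|e| = 2 -> e \notin p.1 -> e \notin p.2 ->
  ((p.1, e |: p.2) \in marked X) = (p \in marked (X :\: e)).
Proof.
move=> eX e2 e1 e2'; rewrite ![_ \in marked _]finset.in_set /= finset.setUCA matchingU1 ?inE ?(negPf e1) //.
by rewrite disjoint_sym disjoint_setU1 e1 disjoint_sym.
Qed.

(** Reveal the partner [x] of the half-edge [a] and whether their edge is
    removed: what is left is an arbitrary marked pairing of the other half-
    edges. All exact counts below come from this recursion. *)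
Lemma marked_sum_expose X a (G : {set {set H}} -> {set {set H}} -> nat) : a \in X ->
  \sum_(p in marked X) G p.1 p.2 =
  \sum_(x in X :\ a) \sum_(p in marked (X :\: [set a; x]))
     (G ([set a; x] |: p.1) p.2 + G p.1 ([set a; x] |: p.2)).
Proof.
move=> aX.
transitivity (\sum_(p in marked X) \sum_(x in X :\ a)
  ([set a; x] \in p.1 :|: p.2) * G p.1 p.2).
  apply: eq_bigr => p /markedP[pX _].
  by rewrite -big_distrl /= (partner_unique pX aX) mul1n.
rewrite exchange_big /=; apply: eq_bigr => x /setD1P[xa xX].
set e := [set a; x].
have eX : e \subset X by rewrite finset.subUset !finset.sub1set aX.
have e2 : #|e| = 2 by rewrite cards2 eq_sym xa.
transitivity (\sum_(p in marked X) ((e \in p.1) * G p.1 p.2 + (e \in p.2) * G p.1 p.2)).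
  apply: eq_bigr => p /markedP[_ dp]; rewrite -mulnDl inE; congr (_ * _)%N.
  have [e1|//] := boolP (e \in p.1).
  by rewrite (disjointFr dp e1).
rewrite !big_split /=; congr (_ + _).
- under eq_bigr do rewrite mulnbl.
  rewrite -big_mkcondr /=.
  rewrite (@reindex_onto _ _ _ _ _ (fun p => (e |: p.1, p.2)) (fun p => (p.1 :\ e, p.2))) /=; last first.
    by case=> p1 p2 /= /andP[_ ep]; rewrite finset.setD1K.
  apply: eq_bigl => -[p1 p2] /=; rewrite setU11 andbT xpair_eqE eqxx andbT.
  apply/andP/idP => [[pm /eqP p1e]|pm].
    have e1 : e \notin p1 by rewrite -p1e setD11.
    have e2' : e \notin p2 by case/markedP: pm => /= _ /disjointFr ->; rewrite ?setU11.
    by rewrite -(@markedU1l X e (p1,p2)).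
  have ax : a \notin X :\: e by rewrite !inE eqxx.
  have [e1 e2'] := marked_fresh pm (set21 a x) ax.
  by rewrite (@markedU1l X e (p1,p2)) /= ?e1 ?e2' // finset.setU1K ?e1.
- under eq_bigr do rewrite mulnbl.
  rewrite -big_mkcondr /=.
  rewrite (@reindex_onto _ _ _ _ _ (fun p => (p.1, e |: p.2)) (fun p => (p.1, p.2 :\ e))) /=; last first.
    by case=> p1 p2 /= /andP[_ ep]; rewrite finset.setD1K.
  apply: eq_bigl => -[p1 p2] /=; rewrite setU11 andbT xpair_eqE eqxx /=.
  apply/andP/idP => [[pm /eqP p1e]|pm].
    have e2' : e \notin p2 by rewrite -p1e setD11.
    have e1 : e \notin p1.
      by case/markedP: pm => /= _; rewrite disjoint_sym => /disjointFr ->; rewrite ?setU11.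
    by rewrite -(@markedU1r X e (p1,p2)).
  have ax : a \notin X :\: e by rewrite !inE eqxx.
  have [e1 e2'] := marked_fresh pm (set21 a x) ax.
  by rewrite (@markedU1r X e (p1,p2)) /= ?e1 ?e2' // finset.setU1K ?e2'.
Qed.

End Matchings.

(** * Connectivity by cuts *)

Section Connectivity.
Variables (V H : finType) (pi : H -> V).
Implicit Types (x y : H) (u v : V) (U W : {set V}) (X Y e : {set H}) (S F : {set {set H}}).

Definition saturated F Y := [forall e in F, (e \subset Y) || [disjoint e & Y]].

(** Connectivity is expressed by cuts rather than by walks: cuts are easy to
    follow when an edge is subdivided, and the failure of connectivity is then
    a union over vertex sets, as a first moment bound requires. *)
Definition spans W F : bool :=
  [forall U : {set V}, saturated F (pi @^-1: U) ==> [disjoint U & W] || (W \subset U)].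

Lemma saturatedU1 e F Y :
  saturated (e |: F) Y = ((e \subset Y) || [disjoint e & Y]) && saturated F Y.
Proof.
apply/forall_inP/andP => [h|[he /forall_inP h] e' /setU1P[->//|/h//]].
by split; [rewrite h ?setU11|apply/forall_inP => e' ?; rewrite h ?setU1r].
Qed.

Lemma pair_saturated x y Y :
  ([set x; y] \subset Y) || [disjoint [set x; y] & Y] = ((x \in Y) == (y \in Y)).
Proof.
rewrite finset.subUset !finset.sub1set disjoint_setU1 disjoints1.
by case: (x \in Y); case: (y \in Y).
Qed.

Lemma eq_saturated F Y Y' : (forall e, e \in F -> {in e, Y =i Y'}) ->
  saturated F Y = saturated F Y'.
Proof.
move=> h; apply: eq_forallb_in => e eF.
have h1 : e :&: Y = e :&: Y'.
  by apply/setP => z; rewrite !inE; case: (boolP (z \in e)) => //= /(h e eF).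
by rewrite -!finset.setI_eq0 !(sameP finset.setIidPl eqP) h1.
Qed.

Definition over W F := forall e x, e \in F -> x \in e -> pi x \in W.

Lemma over_marked W p : p \in marked (pi @^-1: W) -> over W p.1 /\ over W p.2.
Proof.
move=> pm; split=> e x ep xe.
  have [/fintype.subsetP/(_ x xe)] := marked_edge pm (introT orP (or_introl ep)).
  by rewrite inE.
have [/fintype.subsetP/(_ x xe)] := marked_edge pm (introT orP (or_intror ep)).
by rewrite inE.
Qed.

Variables (W : {set V}) (v : V) (vW : v \notin W).

Lemma saturated_D1 F U : over W F ->
  saturated F (pi @^-1: (U :\ v)) = saturated F (pi @^-1: U).
Proof.
move=> oF; apply: eq_saturated => e eF x xe; rewrite !inE.
by case: eqP (oF _ _ eF xe) vW => // -> ->.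
Qed.

Lemma saturated_U1 F U : over W F ->
  saturated F (pi @^-1: (v |: U)) = saturated F (pi @^-1: U).
Proof.
move=> oF; apply: eq_saturated => e eF x xe; rewrite !inE.
by case: eqP (oF _ _ eF xe) vW => // -> ->.
Qed.

Lemma spans_isolated F : W != finset.set0 -> over W F -> spans (v |: W) F = false.
Proof.
move=> /set0Pn[w wW] oF; apply/negP => /forallP/(_ [set v]).
have -> : saturated F (pi @^-1: [set v]).
  by rewrite -[[set v]]finset.setU0 saturated_U1 //; apply/forall_inP => e _;
     rewrite finset.preimset0 -finset.setI_eq0 finset.setI0 eqxx orbT.
rewrite /= disjoint_sym disjoint_setU1 inE eqxx /= => /fintype.subsetP/(_ w).
by rewrite !inE wW orbT => /(_ isT)/eqP wv; move: vW; rewrite -wv wW.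
Qed.

Lemma spans_loop a b F : W != finset.set0 -> over W F -> pi a = v -> pi b = v ->
  spans (v |: W) ([set a; b] |: F) = false.
Proof.
move=> W0 oF pa pb; rewrite -(spans_isolated W0 oF).
by apply: eq_forallb => U; rewrite saturatedU1 pair_saturated !inE pa pb eqxx.
Qed.

Lemma disjoint_D1 U : [disjoint U :\ v & W] = [disjoint U & W].
Proof.
by rewrite -!finset.setI_eq0 finset.setIDAC -finset.setIDA (finset.setDidPl _) // disjoint_sym disjoints1.
Qed.

Lemma sub_U1 U : (W \subset v |: U) = (W \subset U).
Proof.
apply/fintype.subsetP/fintype.subsetP => h z zW; have := h z zW; rewrite !inE; last by move=> ->; rewrite orbT.
by case: eqP => // zv; move: vW; rewrite -zv zW.
Qed.

(** A cut of [W] extends to [v] by placing [v] on the side of its only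
    neighbour. *)
Lemma spans_pendant a x F : over W F -> pi a = v -> pi x \in W ->
  spans (v |: W) ([set a; x] |: F) = spans W F.
Proof.
move=> oF pa xW; apply/forallP/forallP => h U; apply/implyP => sU.
- have [xU|xU] := boolP (pi x \in U).
    have /implyP := h (v |: U).
    rewrite saturatedU1 pair_saturated saturated_U1 // sU !inE pa eqxx xU orbT => /(_ isT).
    rewrite disjoint_setU1 !inE eqxx /= finset.subUset => /andP[_].
    by rewrite sub_U1 => ->; rewrite orbT.
  have /implyP := h (U :\ v).
  rewrite saturatedU1 pair_saturated saturated_D1 // sU !inE pa eqxx (negPf xU) andbF => /(_ isT).
  rewrite finset.subUset finset.sub1set !inE eqxx /= orbF.
  rewrite disjoint_sym disjoint_setU1 => /andP[_].
  by rewrite disjoint_sym disjoint_D1 => ->.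
- move: sU; rewrite saturatedU1 pair_saturated !inE pa => /andP[/eqP vx sU].
  have /implyP/(_ sU)/orP[dU|WU] := h U.
    rewrite disjoint_sym disjoint_setU1 vx (disjointFl dU xW) /=.
    by rewrite disjoint_sym dU.
  by rewrite finset.subUset finset.sub1set vx (fintype.subsetP WU) // WU orbT.
Qed.

(** A vertex in the middle of an edge constrains the cuts exactly as a vertex
    hanging from one end of that edge, which reduces the claim to
    [spans_pendant]. *)
Lemma spans_subdivide a b x y F : over W F -> pi a = v -> pi b = v ->
  pi x \in W -> pi y \in W ->
  spans (v |: W) ([set a; x] |: ([set b; y] |: F)) = spans W ([set x; y] |: F).
Proof.
move=> oF pa pb xW yW.
have oF' : over W ([set x; y] |: F).
  move=> e z /setU1P[->|eF ze]; last exact: oF eF ze.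
  by case/set2P => ->.
rewrite -(spans_pendant oF' pa xW); apply: eq_forallb => U; congr (_ ==> _).
rewrite !saturatedU1 !pair_saturated !inE pa pb; case: (saturated _ _); last by rewrite !andbF.
by case: (v \in U); case: (pi x \in U); case: (pi y \in U).
Qed.

End Connectivity.

(** * Suppressing a vertex of degree two *)

Section Contraction.
Variables (V H : finType) (pi : H -> V).
Implicit Types (W : {set V}).

(** Up to normalisation, the probability that the graph over [W] is connected
    and stays so after the removal of [k] uniformly chosen edges; for [k = 0],
    the probability that it is connected. *)
Definition survivals W (k : nat) : nat :=
  \sum_(p in marked (pi @^-1: W)) (spans pi W p.2 && (#|p.1| == k)).

Definition degree v := #|pi @^-1: [set v]|.

Lemma card_cover_marked X (p : {set {set H}} * {set {set H}}) : p \in marked X ->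
  (#|finset.cover p.1| = 2 * #|p.1|)%N /\ (#|X| = 2 * #|p.1| + 2 * #|p.2|)%N.
Proof.
move=> /markedP[pm dp]; split.
  suff pm1 : p.1 \in matchings (finset.cover p.1) by rewrite (card_matching pm1) mulnC.
  case/matchingP: pm => _ tM h; apply/matchingP; split=> //.
    by apply: finset.trivIsetS tM; exact: finset.subsetUl.
  by move=> e ep; apply: h; rewrite inE ep.
rewrite (card_matching pm) cardsU; move: dp; rewrite -finset.setI_eq0 => /eqP ->.
by rewrite cards0; lia.
Qed.

(** The weight of a half-edge [x] is the number of ways to split its edge at a
    new vertex without isolating that vertex: a kept edge gives two kept
    halves, but of the two halves of a removed edge one stays removed and the
    other is kept, which leaves a choice. Hence a weight 2 on removed edges
    and 1 on kept ones. *)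
Lemma marked_weight X (p : {set {set H}} * {set {set H}}) : p \in marked X ->
  \sum_(x in X) (x \in finset.cover p.1).+1 = (#|X| + 2 * #|p.1|)%N.
Proof.
move=> pm; under eq_bigr do rewrite -add1n.
rewrite big_split /= sum1_card; congr (_ + _).
have [<- _] := card_cover_marked pm.
rewrite -sum1_card big_mkcond [RHS]big_mkcond /=; apply: eq_bigr => x _.
case: (boolP (x \in finset.cover _)) => [xc|]; last by rewrite if_same.
case/markedP: pm => /matchingP[<- _ _] _.
suff -> : x \in finset.cover (p.1 :|: p.2) by [].
by rewrite /finset.cover finset.bigcup_setU inE xc.
Qed.

(** The identity on which everything rests. If [W] and [v] stay connected,
    then [v] has kept at least one of its two edges and carries no loop;
    suppressing [v] merges its two edges into one edge, removed if one of the
    two was. Conversely [v] can be put back on any edge, in either direction,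
    and the weights of [marked_weight] count the ways to do so; their sum
    depends only on the number of half-edges and on [k]. *)
Lemma survivals_contract W v k : v \notin W -> degree v = 2 -> W != finset.set0 ->
  survivals (v |: W) k = ((#|pi @^-1: W| + 2 * k) * survivals W k)%N.
Proof.
move=> vW /eqP/cards2P[a [b [ab Eab]]] W0.
have pa : pi a = v by have := set21 a b; rewrite -Eab !inE => /eqP.
have pb : pi b = v by have := set22 a b; rewrite -Eab !inE => /eqP.
set X := pi @^-1: W.
have aX : a \notin X by rewrite inE pa.
have bX : b \notin X by rewrite inE pb.
have inX x : x \in X -> pi x \in W by rewrite inE.
have overX p : p \in marked X -> over pi W p.1 /\ over pi W p.2 by exact: over_marked.
have EX : pi @^-1: (v |: W) = a |: (b |: X).
  by rewrite finset.preimsetU Eab finset.setUA.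
pose G (S F : {set {set H}}) : nat := spans pi W F && (#|S| == k).
(* [x] will be the half-edge joined to [a], and its partner in [p] the one
   joined to [b]. *)
transitivity (\sum_(x in X) \sum_(p in marked X) (x \in finset.cover p.1).+1 * G p.1 p.2); last first.
  rewrite exchange_big /= big_distrr; apply: eq_bigr => p pm /=.
  rewrite -big_distrl /= (marked_weight pm) /G.
  case: eqP => [->|_]; first by [].
  by rewrite andbF !muln0.
rewrite /survivals EX; clearbody X; rewrite (@marked_sum_expose _ _ a (fun S F : {set {set H}} => spans pi (v |: W) F && (#|S| == k) : nat)) ?setU11 //.
rewrite finset.setU1K; last by rewrite finset.in_setU1 negb_or ab.
(* The partner of [a] is not [b]: a loop at [v] would isolate [v]. *)
rewrite big_setU1 //= big1 ?add0n; last first.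
  have -> : (a |: (b |: X)) :\: [set a; b] = X.
    apply/setP => z; rewrite !inE; case: eqP => [->|_] /=; first by rewrite (negPf aX).
    by case: eqP => [->|_] //=; rewrite (negPf bX).
  move=> p /overX[So Fo].
  by rewrite spans_isolated // spans_loop.
apply: eq_bigr => x xX.
have xW : pi x \in W by exact: inX.
have xa : x != a by apply: contraNneq aX => <-.
have xb : x != b by apply: contraNneq bX => <-.
have -> : (a |: (b |: X)) :\: [set a; x] = b |: (X :\ x).
  apply/setP => z; rewrite !inE.
  case: (eqVneq z a) => [->|_] /=; first by rewrite (negPf aX) (negPf ab) andbF.
  by case: (eqVneq z x) => [->|_] /=; rewrite ?(negPf xb).
rewrite (@marked_sum_expose _ _ b (fun S F : {set {set H}} => (spans pi (v |: W) F && (#|[set a; x] |: S| == k)) +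
   (spans pi (v |: W) ([set a; x] |: F) && (#|S| == k)))) ?setU11 //.
rewrite finset.setU1K; last by rewrite !inE (negPf bX) andbF.
rewrite (@marked_sum_expose _ _ x (fun S F : {set {set H}} => (x \in finset.cover S).+1 * G S F)) //.
apply: eq_bigr => y /setD1P[yx yX].
have yW : pi y \in W by exact: inX.
have yb : y != b by apply: contraNneq bX => <-.
have -> : (b |: (X :\ x)) :\: [set b; y] = X :\: [set x; y].
  apply/setP => z; rewrite !inE.
  case: (eqVneq z b) => [->|_] /=; first by rewrite (negPf bX) andbF.
  by case: (z == x); case: (z == y); case: (z \in X).
apply: eq_bigr => p pm.
have pm' : over pi W p.1 /\ over pi W p.2.
  have sub e z : (e \in p.1) || (e \in p.2) -> z \in e -> pi z \in W.
    by move=> /(marked_edge pm)[/fintype.subsetP h _] /h; rewrite finset.in_setD => /andP[_ /inX].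
  by split=> e z ep; apply: sub; rewrite ep ?orbT.
case: pm' => So Fo.
have cov1 : (x \in finset.cover p.1) = false.
  apply/negP => /finset.bigcupP[e e1 xe].
  have [/fintype.subsetP/(_ x xe)] := marked_edge pm (introT orP (or_introl e1)).
  by rewrite !inE eqxx.
have na1 : ([set a; x] \in p.1) = false by apply/negP => /So/(_ (set21 a x)); rewrite pa (negPf vW).
have nb1 : ([set b; y] \in p.1) = false by apply/negP => /So/(_ (set21 b y)); rewrite pb (negPf vW).
have nx1 : ([set x; y] \in p.1) = false.
  apply/negP => h; have [/fintype.subsetP/(_ x (set21 x y))] := marked_edge pm (introT orP (or_introl h)).
  by rewrite !inE eqxx.
have cx : x \in finset.cover ([set x; y] |: p.1).
  by apply/finset.bigcupP; exists [set x; y]; rewrite ?setU11 ?set21.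
(* Four cases, according to which of the edges at [a] and [b] are removed: if
   both are, [v] is isolated; one of them, [v] is pendant; none, [v] subdivides
   a kept edge. *)
rewrite cx cov1 /G spans_isolated //= spans_subdivide // !spans_pendant //.
by rewrite !cardsU1 na1 nb1 nx1 add0n mul1n mulSn mul1n addnA.
Qed.

End Contraction.

(** * Counting pairings with removed edges *)

Section Counting.
Variables (V H : finType) (pi : H -> V).
Implicit Types (X Y : {set H}) (W D : {set V}) (M S F : {set {set H}})
  (p : {set {set H}} * {set {set H}}).

Lemma marked_sum X (G : {set {set H}} -> {set {set H}} -> nat) :
  \sum_(p in marked X) G p.1 p.2 =
  \sum_(M in matchings X) \sum_(S in powerset M) G S (M :\: S).
Proof.
rewrite pair_big_dep /=.
rewrite (@reindex_onto _ _ _ _ _ (fun q : {set {set H}} * {set {set H}} => (q.2, q.1 :\: q.2))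
  (fun p => (p.1 :|: p.2, p.1))) /=; last first.
  move=> [S F] /markedP[_ /= dSF].
  rewrite finset.setDUl finset.setDv finset.set0U; congr (_, _).
  by apply/finset.setDidPl; rewrite disjoint_sym.
apply: eq_bigl => -[M S] /=; rewrite xpair_eqE eqxx andbT [_ \in marked _]finset.in_set /=.
have dSM : [disjoint S & M :\: S] by rewrite -finset.setI_eq0 finset.setIDA finset.setDIl finset.setDv finset.set0I.
rewrite powersetE dSM andbT; have [SM|SM] := boolP (S \subset M).
  have -> : S :|: M :\: S = M.
    by rewrite -{1}(finset.setIidPr SM) finset.setID.
  by rewrite eqxx andbT.
rewrite andbF; apply/negP => /andP[_ /eqP E]; case/negP: SM.
by rewrite -E finset.subsetUl.
Qed.

Lemma marked_total X k :
  \sum_(p in marked X) (#|p.1| == k) = #|matchings X| * 'C(#|X|./2, k).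
Proof.
rewrite (@marked_sum X (fun S _ => #|S| == k)) -sum_nat_const; apply: eq_bigr => M MX.
rewrite (card_matching MX) muln2 doubleK -cards_draws -sum1_card [RHS]big_mkcond [LHS]big_mkcond.
by apply: eq_bigr => S _; rewrite powersetE inE; case: (S \subset M); case: (_ == _).
Qed.

Lemma survivalsE W k : survivals pi W k =
  \sum_(M in matchings (pi @^-1: W)) \sum_(S in powerset M) (spans pi W (M :\: S) && (#|S| == k)).
Proof. by rewrite /survivals (@marked_sum _ (fun S F => spans pi W F && (#|S| == k) : nat)). Qed.

Lemma saturated_sub F F' Y : F \subset F' -> saturated F' Y -> saturated F Y.
Proof. by move=> /fintype.subsetP FF' /forall_inP h; apply/forall_inP => e /FF'/h. Qed.

Lemma spans_sub W F F' : F \subset F' -> spans pi W F -> spans pi W F'.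
Proof.
move=> FF' /forallP h; apply/forallP => U; apply/implyP => s.
exact: (implyP (h U)) (saturated_sub FF' s).
Qed.

Lemma survivals0 W : survivals pi W 0 = #|[set M in matchings (pi @^-1: W) | spans pi W M]|.
Proof.
rewrite survivalsE -sum1_card [RHS]big_mkcond [LHS]big_mkcond; apply: eq_bigr => M _.
rewrite [M \in [set _ in _ | _]]finset.in_set; case: (M \in matchings _) => //=.
rewrite (bigD1 finset.set0) ?powersetE ?finset.sub0set //= big1 => [|S /andP[_ S0]].
  by rewrite cards0 eqxx andbT addn0 finset.setD0; case: spans.
by rewrite cards_eq0 (negPf S0) andbF.
Qed.

(** A graph that is connected after removals was connected before. *)
Lemma survivals_le W k :
  survivals pi W k <= survivals pi W 0 * 'C(#|pi @^-1: W|./2, k).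
Proof.
rewrite survivals0 survivalsE -sum1_card big_distrl /=.
rewrite [X in _ <= X]big_mkcond [X in X <= _]big_mkcond /=; apply: leq_sum => M _.
rewrite [M \in [set _ in _ | _]]finset.in_set; case: ifP => //= MX; rewrite mul1n.
case: ifP => [_|sM].
  rewrite (card_matching MX) muln2 doubleK -cards_draws -sum1_card.
  rewrite [X in _ <= X]big_mkcond [X in X <= _]big_mkcond /=.
  apply: leq_sum => S _; rewrite powersetE inE.
  by case: (S \subset M); case: (_ == _); rewrite ?andbF //= leq_b1.
rewrite big1 // => S _; case: (boolP (spans _ _ _)) => // s.
by rewrite (spans_sub (finset.subsetDl _ _) s) in sM.
Qed.

Lemma survivals_le_total W k :
  survivals pi W k <= #|matchings (pi @^-1: W)| * 'C(#|pi @^-1: W|./2, k).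
Proof.
apply: leq_trans (survivals_le _ _) _; rewrite leq_mul2r survivals0.
by rewrite subset_leq_card ?orbT //; apply/fintype.subsetP => M; rewrite [M \in [set _ in _ | _]]finset.in_set => /andP[].
Qed.

Lemma card_preimset_sum W : #|pi @^-1: W| = \sum_(v in W) degree pi v.
Proof.
rewrite -sum1_card (partition_big pi (mem W)) /=; last by move=> x; rewrite inE.
apply: eq_bigr => v vW; rewrite /degree -sum1_card; apply: eq_bigl => x.
by rewrite !inE; case: eqP => [->|]; rewrite ?vW ?andbF.
Qed.

(** Each vertex that is put back adds two half-edges, so the factors of
    [survivals_contract] form an arithmetic progression. *)
Lemma survivals_contractn D W k : [disjoint D & W] -> {in D, forall v, degree pi v = 2} ->
  W != finset.set0 ->
  survivals pi (D :|: W) k =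
  (\prod_(j < #|D|) (#|pi @^-1: W| + 2 * j + 2 * k)) * survivals pi W k.
Proof.
move: {2}#|D| (erefl #|D|) => n; elim: n D => [|n IH] D.
  by move/eqP; rewrite cards_eq0 => /eqP -> _ _ _; rewrite cards0 big_ord0 mul1n finset.set0U.
move=> Dn dDW dD W0; have /card_gt0P[v vD] : 0 < #|D| by rewrite Dn.
have vW : v \notin W by rewrite (disjointFr dDW vD).
have Dv : #|D :\ v| = n by have := cardsD1 v D; rewrite vD Dn add1n => -[].
have dDv : [disjoint D :\ v & W] by apply: disjointWl dDW; apply: finset.subsetDl.
have dDv2 : {in D :\ v, forall w, degree pi w = 2} by move=> w /setD1P[_ /dD].
rewrite -(finset.setD1K vD) -finset.setUA survivals_contract ?dD //.
- rewrite (IH _ Dv) // finset.setD1K // Dn big_ord_recr /= Dv.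
  rewrite card_preimset_sum (eq_bigl [predU D :\ v & W]); last by move=> w; rewrite !inE.
  have sumD : \sum_(w in D :\ v) degree pi w = n * 2.
    by rewrite (eq_bigr (fun=> 2)) // sum_nat_const Dv.
  rewrite bigU //= sumD -card_preimset_sum.
  by ring.
- by rewrite !inE eqxx /= (negPf vW).
- by apply: contraNneq W0 => /eqP; rewrite finset.setU_eq0 => /andP[].
Qed.

End Counting.

(** * Relabelling the half-edges *)

Section Symmetry.
Variables (H : finType).
Implicit Types (X Y : {set H}) (M S F : {set {set H}}) (p : {set {set H}} * {set {set H}}).

(** Up to normalisation, the probability that no kept edge leaves [Y]. *)
Definition num_saturated X k Y : nat :=
  \sum_(p in marked X) ((#|p.1| == k) && saturated p.2 Y).

Lemma sub_imset_inj (f : H -> H) Y Y' : injective f ->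
  (f @: Y \subset f @: Y') = (Y \subset Y').
Proof.
move=> fi; apply/idP/idP => [/fintype.subsetP h|]; last exact: imsetS.
by apply/fintype.subsetP => y yY; rewrite -(mem_imset _ _ fi); apply: h; apply: imset_f.
Qed.

Lemma num_saturated_imset (f : H -> H) X k Y : injective f -> f @: X = X ->
  num_saturated X k (f @: Y) = num_saturated X k Y.
Proof.
move=> fi fX; pose g M := [set f @: (e : {set H}) | e in M].
have gi : injective g by apply: imset_inj; apply: imset_inj.
rewrite /num_saturated (reindex_inj (h := fun p => (g p.1, g p.2))) /=; last first.
  by move=> [p1 p2] [q1 q2] /= [/gi -> /gi ->].
apply: eq_big => [p|p _].
  rewrite ![_ \in marked _]finset.in_set /= -finset.imsetU !inE -{1}fX imset_partition //.
  rewrite imset_disjoint; last exact: imset_inj.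
  congr (_ && _ && _); apply/forall_inP/forall_inP => h e.
    by move=> ep; rewrite -(card_imset _ fi) h // imset_f.
  by case/imsetP => e' /h e'2 ->; rewrite card_imset.
rewrite card_imset; last exact: imset_inj.
congr (nat_of_bool (_ && _)); apply/forall_inP/forall_inP => h e.
  by move=> ep; have := h (f @: e) (imset_f _ ep); rewrite sub_imset_inj // imset_disjoint.
by case/imsetP => e' /h e'2 ->; rewrite sub_imset_inj // imset_disjoint.
Qed.

(** A permutation of the half-edges that preserves [X] permutes the marked
    pairings of [X], and transpositions lead from [Y] to [Y'] one half-edge at
    a time. *)
Lemma num_saturated_card X k Y Y' : Y \subset X -> Y' \subset X -> #|Y| = #|Y'| ->
  num_saturated X k Y = num_saturated X k Y'.
Proof.
move: {2}#|Y :\: Y'| (erefl #|Y :\: Y'|) => n; elim: n Y => [|n IH] Y En YX Y'X EY.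
  congr num_saturated; apply/eqP; rewrite eqEcard EY leqnn andbT -finset.setD_eq0.
  by rewrite -cards_eq0 En.
have /card_gt0P[y /setDP[yY yY']] : 0 < #|Y :\: Y'| by rewrite En.
have /card_gt0P[z /setDP[zY' zY]] : 0 < #|Y' :\: Y|.
  have := cardsD Y' Y; have := cardsD Y Y'; rewrite finset.setIC En.
  have : #|Y' :&: Y| <= #|Y'| by rewrite subset_leq_card // finset.subsetIl.
  by lia.
have EY2 : tperm y z @: Y = z |: (Y :\ y).
  apply/setP => x; rewrite -{1}(tpermK y z x) mem_imset; last exact: perm_inj.
  rewrite !inE; case: tpermP => [->|->|/eqP/negPf-> /eqP/negPf->] //=.
  - by rewrite eqxx orbF (negPf zY); apply/esym/negbTE; apply: contraNneq zY => <-.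
  - by rewrite yY eqxx.
have fX : tperm y z @: X = X.
  apply/eqP; rewrite eqEcard card_imset ?leqnn ?andbT; last exact: perm_inj.
  apply/fintype.subsetP => _ /imsetP[x xX ->].
  by case: tpermP => // _; [exact: fintype.subsetP Y'X _ zY'|exact: fintype.subsetP YX _ yY].
rewrite -(num_saturated_imset k Y (@perm_inj _ (tperm y z)) fX).
apply: IH => //.
- have -> : tperm y z @: Y :\: Y' = (Y :\: Y') :\ y.
    by apply/setP => x; rewrite EY2 !inE; case: eqP => [->|_]; rewrite ?zY' ?andbF //= andbCA.
  by have := cardsD1 y (Y :\: Y'); rewrite En !inE yY yY' /=; lia.
- by rewrite -fX imsetS.
- by rewrite card_imset //; exact: perm_inj.
Qed.

Local Open Scope ring_scope.

Lemma sum_powerset_prod (R : comNzRingType) (T : finType) (C : {set T}) (f : T -> R) :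
  \sum_(A in powerset C) \prod_(i in A) f i = \prod_(i in C) (1 + f i).
Proof.
rewrite [RHS]big_mkcond /=.
transitivity (\prod_i ((if i \in C then f i else 0) + 1)).
  rewrite bigA_distr big_mkcond /= [RHS]big_mkcond /=; apply: eq_bigr => A _.
  rewrite powersetE /=; have [AC|/subsetPn[x xA xC]] := boolP (A \subset C).
    rewrite big_mkcond; apply: eq_bigr => i _; case: ifP => // /(fintype.subsetP AC) -> //.
  by rewrite (bigD1 x) //= xA (negPf xC) mul0r.
by apply: eq_bigr => i _; case: ifP; rewrite ?add0r // addrC.
Qed.

Lemma sum_powerset_expr (R : comNzRingType) (T : finType) (C : {set T}) (z : R) :
  \sum_(A in powerset C) z ^+ #|A| = (1 + z) ^+ #|C|.
Proof.
rewrite -prodr_const -sum_powerset_prod.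
by apply: eq_bigr => A _; rewrite prodr_const.
Qed.

Variable R : realFieldType.

(** A set that no kept edge crosses is made of whole kept edges and of
    arbitrary half-edges of removed edges; the right-hand side is the
    generating function of such choices. *)
Lemma sum_saturated X p (z : R) : p \in marked X -> 0 <= z ->
  \sum_(Y in powerset X | saturated p.2 Y) z ^+ #|Y|
    <= (1 + z) ^+ (2 * #|p.1|) * (1 + z ^+ 2) ^+ #|p.2|.
Proof.
move=> pm z0; case/markedP: (pm) => /matchingP[cM tM M2] dp.
have [c1 _] := card_cover_marked pm.
pose enc Y := (Y :&: finset.cover p.1, [set e in p.2 | e \subset Y]).
pose D := [set Y in powerset X | saturated p.2 Y].
have decE Y : Y \in D -> Y = (enc Y).1 :|: finset.cover (enc Y).2.
  rewrite inE powersetE => /andP[YX /forall_inP sY]; apply/setP => y; rewrite !inE.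
  apply/idP/orP => [yY|[/andP[]//|]].
    have : y \in X by exact: fintype.subsetP YX _ yY.
    rewrite -cM => /finset.bigcupP[e /setUP[e1|e2] ye]; [left|right].
      by rewrite yY; apply/finset.bigcupP; exists e.
    apply/finset.bigcupP; exists e => //; rewrite inE e2.
    by case/orP: (sY _ e2) => // /disjointFr/(_ ye); rewrite yY.
  by case/finset.bigcupP => e; rewrite inE => /andP[_ /fintype.subsetP eY] /eY.
have enc_inj : {in D &, injective enc}.
  by move=> Y Y' YD Y'D E; rewrite (decE Y YD) (decE Y' Y'D) E.
have card_enc Y : Y \in D -> #|Y| = (#|(enc Y).1| + 2 * #|(enc Y).2|)%N.
  move=> YD; rewrite {1}(decE Y YD) cardsU.
  have -> : (enc Y).1 :&: finset.cover (enc Y).2 = finset.set0.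
    apply/setP => y; rewrite !inE; apply/negP => /andP[/andP[_ /finset.bigcupP[e e1 ye]]].
    case/finset.bigcupP => e'; rewrite inE => /andP[e2 _] ye'.
    have ne : e != e' by apply: contraTneq e2 => <-; rewrite (disjointFr dp e1).
    have := finset.trivIsetP tM e e'; rewrite !inE e1 e2 orbT => /(_ isT isT ne).
    by move/disjointFr/(_ ye); rewrite ye'.
  rewrite cards0 subn0; congr (_ + _)%N; rewrite mulnC.
  have sub2 : {subset (enc Y).2 <= p.1 :|: p.2}.
    by move=> e; rewrite /enc /= !inE => /andP[-> _]; rewrite orbT.
  have t2 : finset.trivIset (enc Y).2 by apply: finset.trivIsetS tM; apply/fintype.subsetP.
  by rewrite -(eqP t2) (eq_bigr (fun=> 2)) ?sum_nat_const // => e /sub2/M2.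
have -> : \sum_(Y in powerset X | saturated p.2 Y) z ^+ #|Y| =
    \sum_(q in enc @: D) z ^+ (#|q.1| + 2 * #|q.2|).
  rewrite big_imset //=; apply: eq_big => [Y|Y YD]; first by rewrite [_ \in D]finset.in_set.
  by rewrite card_enc // [_ \in D]finset.in_set.
rewrite -c1 -!sum_powerset_expr big_distrl /=.
under [X in _ <= X]eq_bigr do rewrite big_distrr /=.
rewrite pair_big /= big_mkcond [X in _ <= X]big_mkcond /=; apply: ler_sum => -[A B] _ /=.
case: ifP => [/imsetP[Y _ [-> ->]]|_]; last first.
  by case: ifP => // _; rewrite mulr_ge0 ?exprn_ge0.
rewrite !powersetE finset.subsetIr; suff -> : [set e in p.2 | e \subset Y] \subset p.2.
  by rewrite exprD exprM.
by apply/fintype.subsetP => e; rewrite inE => /andP[].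
Qed.

(** By [num_saturated_card] the set [Y] may be averaged over all sets of its
    size. For a fixed marked pairing, the number of those that no kept edge
    crosses is a coefficient of the generating function of [sum_saturated],
    hence at most its value at [z] divided by the corresponding power of [z]. *)
Lemma num_saturated_bound X k Y (z : R) : Y \subset X -> 0 <= z ->
  (num_saturated X k Y)%:R * ('C(#|X|, #|Y|)%:R * z ^+ #|Y|) <=
  (#|matchings X| * 'C(#|X|./2, k))%:R * ((1 + z) ^+ (2 * k) * (1 + z ^+ 2) ^+ (#|X|./2 - k)).
Proof.
move=> YX z0.
have -> : (num_saturated X k Y)%:R * ('C(#|X|, #|Y|)%:R * z ^+ #|Y|) =
  \sum_(Y' in [set A : {set H} | A \subset X & #|A| == #|Y|]) (num_saturated X k Y')%:R * z ^+ #|Y'| :> R.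
  rewrite (eq_bigr (fun=> (num_saturated X k Y)%:R * z ^+ #|Y|)); last first.
    move=> Y'; rewrite inE => /andP[Y'X /eqP EY].
    by rewrite EY (num_saturated_card k Y'X YX EY).
  by rewrite sumr_const cards_draws -[RHS]mulr_natl mulrCA.
rewrite -marked_total natr_sum mulr_suml.
under eq_bigr do rewrite /num_saturated natr_sum mulr_suml.
rewrite exchange_big /=; apply: ler_sum => p pm.
have [pk|] := eqVneq #|p.1| k; last by move=> _; rewrite big1 ?mul0r // => Y' _; rewrite mul0r.
have [_ cX] := card_cover_marked pm.
have := sum_saturated pm z0; have -> : (#|X|./2 - k = #|p.2|)%N by rewrite cX pk; lia.
rewrite mul1r -pk; apply: le_trans.
rewrite big_mkcond [X in _ <= X]big_mkcond /=; apply: ler_sum => Y' _.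
rewrite inE powersetE; case: (Y' \subset X) => //=.
by case: (saturated _ _); case: ifP => _; rewrite ?mul0r ?mul1r ?exprn_ge0.
Qed.

End Symmetry.

(** * Small cuts when all degrees are at least three *)

Section Cuts.
Variables (V H : finType) (pi : H -> V).
Implicit Types (X Y : {set H}) (U W : {set V}) (S F : {set {set H}}).

Definition small_cuts W : {set {set V}} :=
  [set U in powerset W | (U != finset.set0) && (#|pi @^-1: U| <= #|pi @^-1: W|./2)].

(** One of the two sides of a cut carries at most half of the half-edges. *)
Lemma small_cut_of_not_spans W p : p \in marked (pi @^-1: W) -> ~~ spans pi W p.2 ->
  exists2 U, U \in small_cuts W & saturated p.2 (pi @^-1: U).
Proof.
move=> pm /forallPn[U]; rewrite negb_imply negb_or => /and3P[sU dUW nWU].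
have [_ Fo] := over_marked pm.
have in_small U' : U' \subset W -> U' != finset.set0 ->
    #|pi @^-1: U'| <= #|pi @^-1: W|./2 -> U' \in small_cuts W.
  by move=> *; rewrite finset.in_set powersetE; apply/and3P.
have sI : saturated p.2 (pi @^-1: (W :&: U)).
  rewrite (@eq_saturated _ p.2 _ (pi @^-1: U)) // => e ep x xe.
  by rewrite !inE (Fo e).
have sD : saturated p.2 (pi @^-1: (W :\: U)).
  apply/forall_inP => e ep; have := forall_inP sU e ep; rewrite orbC => /orP[]h.
    apply/orP; left; apply/fintype.subsetP => x xe; rewrite !inE (Fo e) // andbT.
    by have := disjointFr h xe; rewrite inE => ->.
  apply/orP; right; rewrite -finset.setI_eq0; apply/eqP/setP => x; rewrite !inE.
  apply/negP => /and3P[xe xU _]; have := fintype.subsetP h _ xe; rewrite inE.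
  by rewrite (negPf xU).
have cID : #|pi @^-1: (W :&: U)| + #|pi @^-1: (W :\: U)| = #|pi @^-1: W|.
  rewrite -(cardsID (pi @^-1: U) (pi @^-1: W)).
  by rewrite finset.preimsetI finset.preimsetD.
have I0 : W :&: U != finset.set0 by rewrite finset.setIC finset.setI_eq0.
have D0 : W :\: U != finset.set0 by rewrite finset.setD_eq0.
case: (leqP #|pi @^-1: (W :&: U)| #|pi @^-1: W|./2) => hI.
  by exists (W :&: U) => //; apply: in_small; rewrite ?finset.subsetIl.
by exists (W :\: U) => //; apply: in_small; rewrite ?finset.subsetDl //; lia.
Qed.

Lemma not_spanning_le W k :
  #|matchings (pi @^-1: W)| * 'C(#|pi @^-1: W|./2, k) <=
  survivals pi W k + \sum_(U in small_cuts W) num_saturated (pi @^-1: W) k (pi @^-1: U).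
Proof.
rewrite -marked_total /num_saturated exchange_big /= -big_split /=; apply: leq_sum => p pm.
case: (_ == k); rewrite ?andbT //=.
have [//|ns] := boolP (spans _ _ _).
have [U Uc Us] := small_cut_of_not_spans pm ns.
by rewrite (bigD1 U) //= Us.
Qed.

Local Open Scope ring_scope.
Variable R : realFieldType.

(** Since [z <= 1], the generating function of the numbers of half-edges of
    vertex sets is largest when every degree is three. *)
Lemma card_small_cuts W s (z : R) : {in W, forall v, (3 <= degree pi v)%N} -> 0 <= z <= 1 ->
  #|[set U in small_cuts W | #|pi @^-1: U| == s]|%:R * z ^+ s <= (1 + z ^+ 3) ^+ #|W|.
Proof.
move=> dW /andP[z0 z1].
apply: (@le_trans _ _ (\sum_(U in powerset W) \prod_(v in U) z ^+ degree pi v)); last first.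
  rewrite sum_powerset_prod -prodr_const; apply: ler_prod => v vW.
  by rewrite addr_ge0 ?exprn_ge0 //= lerD2l ler_wiXn2l // dW.
rewrite mulr_natl -sumr_const big_mkcond [X in _ <= X]big_mkcond /=; apply: ler_sum => U _.
rewrite finset.in_set; case: ifP => [/andP[]|_]; last first.
  by case: ifP => // _; apply: prodr_ge0 => v _; rewrite exprn_ge0.
rewrite finset.in_set => /andP[-> _] /eqP <-.
by rewrite card_preimset_sum prodrXr.
Qed.

Lemma card_kernel W : {in W, forall v, (3 <= degree pi v)%N} -> (3 * #|W| <= #|pi @^-1: W|)%N.
Proof. by move=> dW; rewrite card_preimset_sum mulnC -sum_nat_const; apply: leq_sum. Qed.

(** For this [w] the term of index [s] is the largest of the binomial
    expansion, and from index [2 * s] on each term is at most half of the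
    previous one. So the whole sum is worth at most [2 * s + 2] times its
    largest term. *)
Lemma binomial_sum_le_mode n s (w : R) : (0 < s)%N -> (2 * s <= n)%N ->
  w = s%:R / (n - s)%:R -> (1 + w) ^+ n <= (2 * s + 2)%:R * ('C(n, s)%:R * w ^+ s).
Proof.
move=> s0 sn Ew; pose t i := 'C(n, i)%:R * w ^+ i.
have ns0 : 0 < (n - s)%:R :> R by rewrite ltr0n; lia.
have w0 : 0 < w by rewrite Ew divr_gt0 // ltr0n.
have Ews : w * (n - s)%:R = s%:R by rewrite Ew divfK // gt_eqF.
have t0 i : 0 <= t i by rewrite mulr_ge0 // exprn_ge0 // ltW.
have tS i : t i.+1 * i.+1%:R = t i * (w * (n - i)%:R).
  have := mul_bin_left n i; move/(congr1 (fun x => x%:R : R)); rewrite !natrM => E.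
  transitivity (w * w ^+ i * (i.+1%:R * 'C(n, i.+1)%:R)); first by rewrite /t exprS; ring.
  by rewrite E /t; ring.
have wle i : (s <= i)%N -> w * (n - i)%:R <= s%:R.
  by move=> si; rewrite -Ews ler_pM2l // ler_nat; lia.
have t_dec i : (s <= i)%N -> t i.+1 <= t i.
  move=> si; rewrite -(ler_pM2r (x := i.+1%:R)) ?ltr0n // tS ler_wpM2l //.
  by apply: le_trans (wle _ si) _; rewrite ler_nat; lia.
have t_half i : (2 * s <= i)%N -> 2 * t i.+1 <= t i.
  move=> si; rewrite -(ler_pM2r (x := i.+1%:R)) ?ltr0n // -mulrA tS mulrCA ler_wpM2l //.
  have /wle : (s <= i)%N by lia.
  have : (2 * s)%:R <= i.+1%:R :> R by rewrite ler_nat; lia.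
  by rewrite natrM; lra.
have t_inc i : (i < s)%N -> t i <= t i.+1.
  move=> si; rewrite -(ler_pM2r (x := i.+1%:R)) ?ltr0n // tS ler_wpM2l //.
  apply: (@le_trans _ _ s%:R); first by rewrite ler_nat.
  by rewrite -Ews ler_pM2l // ler_nat; lia.
have t_up j : t (s + j)%N <= t s.
  by elim: j => [|j]; rewrite ?addn0 // addnS; apply: le_trans; apply: t_dec; lia.
have t_down j : t (s - j)%N <= t s.
  elim: j => [|j]; rewrite ?subn0 //; apply: le_trans.
  have [sj|sj] := leqP s j; first by rewrite (_ : (s - j.+1 = s - j)%N) //; lia.
  have -> : (s - j = (s - j.+1).+1)%N by lia.
  by apply: t_inc; lia.
have t_mode i : t i <= t s.
  have [si|si] := leqP s i; first by rewrite -(subnKC si).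
  by rewrite -(subKn (ltnW si)).
have tail j : \sum_(i < 2 * s + j) t i + 2 * t (2 * s + j)%N <= (2 * s + 2)%:R * t s.
  elim: j => [|j IH]; last first.
    rewrite addnS big_ord_recr /=; have := t_half (2 * s + j)%N (leq_addr _ _).
    by move: IH; lra.
  rewrite addn0 natrD [X in _ <= X]mulrDl; apply: lerD; last by rewrite ler_wpM2l.
  apply: (@le_trans _ _ (\sum_(i < 2 * s) t s)); first exact: ler_sum.
  by rewrite sumr_const card_ord mulr_natl.
rewrite exprDn; have <- := subnKC (leqW sn).
apply: le_trans (tail (n.+1 - 2 * s)%N).
rewrite (eq_bigr (fun i : 'I__ => t i)); first by rewrite lerDl mulr_ge0.
by move=> i _; rewrite expr1n mul1r /t mulr_natl.
Qed.

(** Three estimates meet here: [card_small_cuts] at [z = y ^+ 2] for the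
    number of sets, [num_saturated_bound] at [z = y ^+ 3] for the probability
    of each of them, and [binomial_sum_le_mode] at [w = y ^+ 6] for the
    binomial coefficient. With these choices every exponential factor is a
    power of [1 + y ^+ 6], and the powers of [y] combine to [y ^+ s]. The gain
    comes from degrees at least three, through [#|W| < m]. *)
Lemma small_cut_term W k s (y : R) : {in W, forall v, (3 <= degree pi v)%N} ->
  let m := #|pi @^-1: W|./2 in
  (#|pi @^-1: W| = 2 * m)%N -> (0 < s <= m)%N -> (k <= m)%N -> 0 < y -> 
  y ^+ 6 = s%:R / (2 * m - s)%:R ->
  \sum_(U in small_cuts W | #|pi @^-1: U| == s) (num_saturated (pi @^-1: W) k (pi @^-1: U))%:R
  <= (#|matchings (pi @^-1: W)| * 'C(m, k))%:R *
     ((2 * s + 2)%:R * y ^+ s * (1 + y ^+ 3) ^+ (2 * k) / (1 + y ^+ 6) ^+ (m - #|W|)).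
Proof.
move=> dW m Em /andP[s0 sm] km y0 Ey.
set Tot := (_ * 'C(m, k))%N; set w := y ^+ 6.
have w0 : 0 < w by rewrite exprn_gt0.
have Wm : (#|W| <= m)%N by have := card_kernel dW; lia.
have w1 : w <= 1 by rewrite /w Ey ler_pdivrMr ?mul1r ?ler_nat ?ltr0n; lia.
have y1 : y <= 1 by rewrite -(@expr_le1 _ 6) // ltW.
have mode := binomial_sum_le_mode s0 _ Ey.
have /mode {}mode : (2 * s <= 2 * m)%N by lia.
pose a := #|[set U in small_cuts W | #|pi @^-1: U| == s]|.
pose g := (1 + y ^+ 3) ^+ (2 * k) * (1 + w) ^+ (m - k).
have C0 : 0 < 'C(2 * m, s)%:R :> R by rewrite ltr0n bin_gt0; lia.
have perU U : U \in small_cuts W -> #|pi @^-1: U| == s ->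
  (num_saturated (pi @^-1: W) k (pi @^-1: U))%:R <= Tot%:R * g / ('C(2 * m, s)%:R * y ^+ (3 * s)).
  rewrite finset.in_set powersetE => /andP[UW _] /eqP Es.
  rewrite ler_pdivlMr; last by rewrite mulr_gt0 ?exprn_gt0.
  have := @num_saturated_bound _ R (pi @^-1: W) k (pi @^-1: U) (y ^+ 3) (finset.preimsetS _ UW).
  by rewrite Em Es mul2n doubleK -!exprM /= -/Tot => /(_ (exprn_ge0 _ (ltW y0))).
have aB : a%:R * y ^+ (2 * s) <= (1 + w) ^+ #|W|.
  have y2in : 0 <= y ^+ 2 <= 1 by rewrite exprn_ge0 ?exprn_ile1 // ltW.
  by have := @card_small_cuts W s (y ^+ 2) dW y2in; rewrite -!exprM.
apply: (@le_trans _ _ (a%:R * (Tot%:R * g / ('C(2 * m, s)%:R * y ^+ (3 * s))))).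
  rewrite mulr_natl -sumr_const big_mkcond [X in _ <= X]big_mkcond /=; apply: ler_sum => U _.
  by rewrite [in X in _ <= X]finset.in_set; case: ifP => // /andP[]; exact: perU.
rewrite -[_ * g / _]mulrA [_ * (Tot%:R * _)]mulrCA; apply: ler_wpM2l; first exact: ler0n.
have y2 : 0 < y ^+ (2 * s) by rewrite exprn_gt0.
have y3 : 0 < y ^+ (3 * s) by rewrite exprn_gt0.
have p1w i : 0 < (1 + w) ^+ i by rewrite exprn_gt0 // addr_gt0.
have p1y : 0 < (1 + y ^+ 3) ^+ (2 * k) by rewrite exprn_gt0 // addr_gt0 // exprn_gt0.
have g0 : 0 < g by rewrite mulr_gt0.
have aB' : a%:R <= (1 + w) ^+ #|W| / y ^+ (2 * s) by rewrite ler_pdivlMr.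
apply: le_trans (_ : (1 + w) ^+ #|W| / y ^+ (2 * s) * (g / ('C(2 * m, s)%:R * y ^+ (3 * s))) <= _).
  by rewrite ler_wpM2r // divr_ge0 ?ltW // mulr_gt0.
have Ci : ('C(2 * m, s)%:R)^-1 <= (2 * s + 2)%:R * w ^+ s / (1 + w) ^+ (2 * m).
  by rewrite ler_pdivlMr // mulrC ler_pdivrMr // [X in _ <= X]mulrC mulrCA.
apply: (@le_trans _ _ ((1 + w) ^+ #|W| / y ^+ (2 * s) * g / y ^+ (3 * s) *
   ((2 * s + 2)%:R * w ^+ s / (1 + w) ^+ (2 * m)))).
  have -> : (1 + w) ^+ #|W| / y ^+ (2 * s) * (g / ('C(2 * m, s)%:R * y ^+ (3 * s))) =
    (1 + w) ^+ #|W| / y ^+ (2 * s) * g / y ^+ (3 * s) * ('C(2 * m, s)%:R)^-1.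
    by field; rewrite !gt_eqF.
  by apply: ler_wpM2l Ci; rewrite ltW // !mulr_gt0 ?invr_gt0.
have E2 : (1 + w) ^+ (2 * m) = (1 + w) ^+ #|W| * (1 + w) ^+ (m - #|W|) * ((1 + w) ^+ (m - k) * (1 + w) ^+ k).
  by rewrite -!exprD subnKC // subnK // addnn -mul2n.
have Ew : w ^+ s = y ^+ (2 * s) * y ^+ (3 * s) * y ^+ s by rewrite /w -exprM -!exprD -mulnDl -mulSnr.
rewrite E2 Ew /g.
have -> : (1 + w) ^+ #|W| / y ^+ (2 * s) * ((1 + y ^+ 3) ^+ (2 * k) * (1 + w) ^+ (m - k)) / y ^+ (3 * s) *
  ((2 * s + 2)%:R * (y ^+ (2 * s) * y ^+ (3 * s) * y ^+ s) / ((1 + w) ^+ #|W| * (1 + w) ^+ (m - #|W|) * ((1 + w) ^+ (m - k) * (1 + w) ^+ k)))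
  = (2 * s + 2)%:R * y ^+ s * (1 + y ^+ 3) ^+ (2 * k) / (1 + w) ^+ (m - #|W|) / (1 + w) ^+ k.
  by field; rewrite !gt_eqF.
rewrite ler_pdivrMr // ler_peMr //.
  have c0 : 0 < (2 * s + 2)%:R :> R by rewrite ltr0n addn2.
  have ys : 0 < y ^+ s by rewrite exprn_gt0.
  by apply: ltW; rewrite divr_gt0 // !mulr_gt0.
by rewrite exprn_ege1 // lerDl ltW.
Qed.

End Cuts.

Local Open Scope ring_scope.

(** * The kernel survives the removals *)

Section Kernel.
Variable R : realType.

Lemma powR_root6 (w : R) : 0 < w -> (w `^ 6^-1) ^+ 6 = w.
Proof.
by move=> w0; rewrite -powR_mulrn ?powR_ge0 // -powRrM mulVf ?powRr1 ?ltW.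
Qed.

Lemma expR_half_le (w : R) : 0 <= w <= 1 -> expR (w / 2) <= 1 + w.
Proof.
move=> /andP[w0 w1]; have h := expR_ge1Dx (- (w / 2)).
have E : expR (w / 2) * expR (- (w / 2)) = 1 by rewrite -expRD subrr expR0.
have p := expR_gt0 (w / 2); nra.
Qed.

Lemma sqr_le_expR (x : R) : 0 <= x -> x ^+ 2 <= expR (2 * x).
Proof.
move=> x0; rewrite mulr_natl mulr2n expRD -expr2 ler_sqr ?nnegrE ?expR_ge0 //.
by apply: le_trans (expR_ge1Dx x); rewrite lerDr.
Qed.

(** The factor [y ^+ s] is at most [s%:R * mu], where [mu] is the power [-1/6]
    of [m]. The denominator is at least [expR (s%:R / 12)], which outweighs
    the polynomial in [s] and the contribution of the removed edges, of order
    [expR (2 * c * Num.sqrt s%:R)]. What remains decays geometrically in [s]. *)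
Lemma cut_estimate (c y mu : R) (m s k N : nat) : 0 <= c -> (0 < s <= m)%N ->
  (3 * N <= 2 * m)%N -> k%:R <= c * Num.sqrt m%:R -> 0 < y -> 0 < mu ->
  y ^+ 6 = s%:R / (2 * m - s)%:R -> mu ^+ 6 = m%:R^-1 ->
  (2 * s + 2)%:R * y ^+ s * (1 + y ^+ 3) ^+ (2 * k) / (1 + y ^+ 6) ^+ (m - N)
  <= 4 * 96 ^+ 2 * expR (24 * c ^+ 2) * mu * expR (- 48^-1) ^+ s.
Proof.
move=> c0 /andP[s0 sm] Nm.
have mN3 : (m <= (m - N) * 3)%N by lia.
have sm1 : (m <= 2 * m - s)%N by lia.
have sm2 : (2 * m - s <= 2 * m)%N by lia.
have m_gt0 : (0 < m)%N by lia.
move=> kc y0 mu0 Ey Emu.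
have m0 : 0 < m%:R :> R by rewrite ltr0n.
have s1 : 1 <= s%:R :> R by rewrite ler1n.
have sm' : s%:R <= m%:R :> R by rewrite ler_nat.
have d1 : m%:R <= (2 * m - s)%:R :> R by rewrite ler_nat.
have d2 : (2 * m - s)%:R <= 2 * m%:R :> R by rewrite -natrM ler_nat.
have d0 : 0 < (2 * m - s)%:R :> R by apply: lt_le_trans d1.
have w_le : y ^+ 6 <= s%:R / m%:R.
  by rewrite Ey ler_pM2l ?lef_pV2 ?posrE // (lt_le_trans _ s1).
have w_ge : s%:R / (2 * m%:R) <= y ^+ 6.
  by rewrite Ey ler_pM2l ?lef_pV2 ?posrE ?mulr_gt0 // (lt_le_trans _ s1).
have w1 : y ^+ 6 <= 1 by apply: le_trans w_le _; rewrite ler_pdivrMr // mul1r.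
have y1 : y <= 1 by rewrite -(@expr_le1 _ 6) // ltW.
have y0' := ltW y0.
have mu0' := ltW mu0.
have y3 : 0 <= y ^+ 3 by rewrite exprn_ge0 // ltW.
have y6 : 0 <= y ^+ 6 by rewrite exprn_ge0 // ltW.
have y_le : y ^+ s <= s%:R * mu.
  apply: (@le_trans _ _ y).
    by rewrite -[X in _ <= X]expr1; apply: ler_wiXn2l => //; rewrite ltW.
  rewrite -(@ler_pXn2r _ 6) ?nnegrE ?(ltW y0) ?mulr_ge0 ?(ltW mu0) //.
  apply: le_trans w_le _; rewrite exprMn Emu ler_pM2r ?invr_gt0 //.
  by rewrite -[X in X <= _]expr1; apply: ler_weXn2l.
(* 2 k y^3 <= 2 c sqrt s <= 24 c^2 + s / 24 by the inequality between the
   arithmetic and the geometric mean; any fraction of s below 1/12 would do. *)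
have marks : (1 + y ^+ 3) ^+ (2 * k) <= expR (24 * c ^+ 2 + s%:R / 24).
  apply: (@le_trans _ _ (expR (y ^+ 3) ^+ (2 * k))).
    by rewrite lerXn2r ?nnegrE ?expR_ge0 ?addr_ge0 // expR_ge1Dx.
  rewrite -expRM_natl ler_expR natrM -mulrA.
  have u2 : (k%:R * y ^+ 3) ^+ 2 <= c ^+ 2 * s%:R.
    rewrite exprMn -exprM; apply: le_trans (_ : (c * Num.sqrt m%:R) ^+ 2 * (s%:R / m%:R) <= _).
      by rewrite ler_pM ?exprn_ge0 // lerXn2r ?nnegrE ?mulr_ge0 ?sqrtr_ge0.
    by rewrite exprMn sqr_sqrtr ?(ltW m0) // mulrA -(mulrA (c ^+ 2)) (mulrC m%:R) mulrA mulfK // gt_eqF.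
  have u0 : 0 <= k%:R * y ^+ 3 by rewrite mulr_ge0 // exprn_ge0 // ltW.
  rewrite -(@ler_pXn2r _ 2) ?nnegrE ?mulr_ge0 ?addr_ge0 ?mulr_ge0 ?exprn_ge0 ?divr_ge0 ?ler0n //.
  rewrite exprMn; set u := _ * y ^+ 3 in u2 *; move: (c ^+ 2) u2 => C; move: s%:R => S.
  by move=> h; have := sqr_ge0 (24 * C - S / 24); nra.
have growth : expR (s%:R / 12) <= (1 + y ^+ 6) ^+ (m - N).
  apply: (@le_trans _ _ (expR (y ^+ 6 / 2) ^+ (m - N))); last first.
    by rewrite lerXn2r ?nnegrE ?expR_ge0 ?addr_ge0 // expR_half_le ?y6.
  rewrite -expRM_natl ler_expR.
  have mN : m%:R / 3 <= (m - N)%:R :> R.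
    by rewrite ler_pdivrMr // -natrM ler_nat.
  apply: le_trans (_ : m%:R / 3 * (s%:R / (2 * m%:R) / 2) <= _).
    by rewrite le_eqVlt; apply/orP; left; apply/eqP; field; rewrite gt_eqF.
  rewrite ler_pM ?divr_ge0 ?mulr_ge0 //.
  by rewrite ler_pM2r.
have ss : (2 * s + 2)%:R * s%:R <= 4 * 96 ^+ 2 * expR (s%:R / 48) :> R.
  have := @sqr_le_expR (s%:R / 96); rewrite divr_ge0 // => /(_ isT).
  have -> : 2 * (s%:R / 96) = s%:R / 48 :> R by lra.
  by rewrite natrD natrM; nra.
apply: (@le_trans _ _ ((2 * s + 2)%:R * (s%:R * mu) * expR (24 * c ^+ 2 + s%:R / 24) / expR (s%:R / 12))).
  have q1 : 0 < (1 + y ^+ 6) ^+ (m - N) by rewrite exprn_gt0 // ltr_pwDl.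
  apply: ler_pM; rewrite ?invr_ge0 ?(ltW q1) //.
  - by rewrite !mulr_ge0 // exprn_ge0 // addr_ge0.
  - apply: ler_pM => //; rewrite ?exprn_ge0 ?addr_ge0 //; first by rewrite mulr_ge0 // exprn_ge0.
    by rewrite ler_wpM2l.
  - by rewrite lef_pV2 ?posrE ?expR_gt0.
have e1 : expR (s%:R / 48) * expR (- (s%:R / 48)) = 1 :> R by rewrite -expRD subrr expR0.
set em := expR (- (s%:R / 48)) in e1.
have E : expR (24 * c ^+ 2 + s%:R / 24) / expR (s%:R / 12) =
   expR (24 * c ^+ 2) * (expR (- 48^-1) ^+ s * em).
  by rewrite -expRN -expRM_natl -!expRD; congr expR; lra.
rewrite -mulrA E.
have -> : (2 * s + 2)%:R * (s%:R * mu) * (expR (24 * c ^+ 2) * (expR (- 48^-1) ^+ s * em)) =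
  ((2 * s + 2)%:R * s%:R * em) * (expR (24 * c ^+ 2) * mu * expR (- 48^-1) ^+ s) by ring.
rewrite -[X in _ <= X]mulrA -[X in _ <= X]mulrA [X in _ <= _ * X]mulrA.
apply: ler_wpM2r; first by rewrite !mulr_ge0 ?exprn_ge0 ?expR_ge0.
apply: le_trans (ler_wpM2r _ ss) _; first exact: expR_ge0.
by rewrite -[X in X <= _]mulrA e1 mulr1.
Qed.


Lemma sum_geometric_le (r : R) n : 0 <= r < 1 -> \sum_(i < n) r ^+ i <= (1 - r)^-1.
Proof.
move=> /andP[r0 r1]; have d0 : 0 < 1 - r by rewrite subr_gt0.
rewrite -(ler_pM2l d0) mulfV ?gt_eqF // -opprB mulNr -subrX1 opprB.
by rewrite lerBlDr lerDl exprn_ge0.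
Qed.

(** When all degrees are at least three, the removal of order [Num.sqrt m%:R]
    edges leaves the graph connected with high probability, whether or not one
    conditions on connectedness. The expected number of small cuts is summed
    over the number [s] of their half-edges by [cut_estimate]. *)
Lemma kernel_survival (c : R) : 0 <= c -> exists2 K : R, 0 <= K &
  forall (V H : finType) (pi : H -> V) (W : {set V}) (m k : nat) (mu : R),
    {in W, forall v, (3 <= degree pi v)%N} -> #|pi @^-1: W| = (2 * m)%N ->
    (0 < m)%N -> (k <= m)%N -> k%:R <= c * Num.sqrt m%:R ->
    0 < mu -> mu ^+ 6 = m%:R^-1 ->
    (#|matchings (pi @^-1: W)| * 'C(m, k))%:R * (1 - K * mu) <= (survivals pi W k)%:R.
Proof.
move=> c0; pose r : R := expR (- 48^-1).
have r01 : 0 <= r < 1 by rewrite expR_ge0 expR_lt1 oppr_lt0 invr_gt0 ltr0n.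
have dr : 0 < 1 - r by case/andP: r01 => _ r1; rewrite subr_gt0.
exists (4 * 96 ^+ 2 * expR (24 * c ^+ 2) / (1 - r)).
  by rewrite !mulr_ge0 ?expR_ge0 // invr_ge0 ltW.
move=> V' H' pi' W m k mu dW Em m0 km kc mu0 Emu.
have Em2 : (#|pi' @^-1: W|./2 = m)%N by rewrite Em mul2n doubleK.
have := not_spanning_le pi' W k; rewrite Em2 -(ler_nat R) natrD natr_sum.
set Tot : R := (_ * 'C(m, k))%:R; set cuts := \sum_(_ in _) _ => h.
suff : cuts <= Tot * (4 * 96 ^+ 2 * expR (24 * c ^+ 2) / (1 - r) * mu).
  by rewrite mulrBr mulr1; lra.
have small U : U \in small_cuts pi' W -> (0 < #|pi' @^-1: U| <= m)%N.
  rewrite finset.in_set powersetE Em2 => /and3P[UW /set0Pn[v vU] ->]; rewrite andbT.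
  rewrite card_preimset_sum (bigD1 v) //=; have := dW v (fintype.subsetP UW _ vU).
  by case: (degree _ _).
rewrite /cuts (partition_big (fun U : {set V'} => inord #|pi' @^-1: U| : 'I_m.+1) predT) //=.
apply: (@le_trans _ _ (\sum_(s < m.+1) Tot * (4 * 96 ^+ 2 * expR (24 * c ^+ 2) * mu) * r ^+ s)); last first.
  rewrite -mulr_sumr; have /(_ m.+1) := sum_geometric_le _ r01.
  have -> : Tot * (4 * 96 ^+ 2 * expR (24 * c ^+ 2) / (1 - r) * mu) =
    Tot * (4 * 96 ^+ 2 * expR (24 * c ^+ 2) * mu) * (1 - r)^-1 by ring.
  by apply: ler_wpM2l; rewrite !mulr_ge0 ?expR_ge0 ?ler0n // ltW.
apply: ler_sum => s _.
have [s0|s0] := posnP s.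
  rewrite big_pred0 => [|U]; first by rewrite !mulr_ge0 ?expR_ge0 ?exprn_ge0 ?ler0n ?expR_ge0 // ltW.
  apply/negP => /andP[/small/andP[U0 Um]] /eqP E.
  by move: U0; rewrite -(@inordK m #|_|) ?ltnS // E s0.
have sm : (0 < s <= m)%N by rewrite s0 -ltnS ltn_ord.
have w0 : 0 < s%:R / (2 * m - s)%:R :> R by rewrite divr_gt0 // ltr0n; lia.
have y0 := powR_gt0 6^-1 w0; have Ey := powR_root6 w0.
set y := _ `^ 6^-1 in y0 Ey.
rewrite (eq_bigl (fun U => (U \in small_cuts pi' W) && (#|pi' @^-1: U| == s))); last first.
  move=> U /=; case: (boolP (U \in small_cuts pi' W)) => //= /small/andP[_ Um].
  by rewrite -val_eqE /= inordK.
have := @small_cut_term _ _ pi' R W k s y dW; rewrite Em2 => /(_ Em sm km y0 Ey) h2.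
apply: le_trans h2 _; rewrite -/Tot -[X in _ <= X]mulrA; apply: ler_wpM2l; first exact: ler0n.
apply: cut_estimate => //.
by have := card_kernel dW; rewrite Em.
Qed.

End Kernel.

Local Close Scope ring_scope.

(** * Removal orders and the disconnection time *)

Section Orderings.
Variables (T : finType).
Implicit Types (M S : {set T}).

(** Such an ordering is an ordering of [S] followed by one of its complement. *)
Lemma count_orderings_prefix M S k : S \subset M -> #|S| = k ->
  count (fun s => [set:: take k s] == S) (permutations (enum M)) = k`! * (#|M| - k)`!.
Proof.
move=> SM Sk; rewrite -size_filter.
have pe : perm_eq [seq s <- permutations (enum M) | [set:: take k s] == S]
    [seq a ++ b | a <- permutations (enum S), b <- permutations (enum (M :\: S))].
  apply: uniq_perm.
  - by rewrite filter_uniq // permutations_uniq.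
  - apply: allpairs_uniq; rewrite ?permutations_uniq // => -[a b] [a' b'] /=.
    move=> /allpairsP[[u v] /= [ua vb [-> ->]]] /allpairsP[[u' v'] /= [ua' vb' [-> ->]]].
    move: ua ua'; rewrite !mem_permutations => /perm_size su /perm_size su' /eqP.
    by rewrite eqseq_cat ?su ?su' // => /andP[/eqP-> /eqP->].
  - move=> s; rewrite mem_filter mem_permutations; apply/andP/allpairsP.
      case=> /eqP tS sM; exists (take k s, drop k s); rewrite /= cat_take_drop; split=> //.
        rewrite mem_permutations; apply: uniq_perm.
        + by apply: take_uniq; rewrite (perm_uniq sM) enum_uniq.
        + exact: enum_uniq.
        + by move=> x; rewrite mem_enum -tS inE.
      have us : uniq (take k s ++ drop k s) by rewrite cat_take_drop (perm_uniq sM) enum_uniq.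
      rewrite mem_permutations; apply: uniq_perm.
      + by move: us; rewrite cat_uniq => /and3P[].
      + exact: enum_uniq.
      + move=> x; rewrite mem_enum inE -tS inE -(mem_enum M) -(perm_mem sM) -{3}(cat_take_drop k s) mem_cat.
        move: us; rewrite cat_uniq => /and3P[_ /hasPn h _].
        by case: (boolP (x \in drop k s)) => [/h ->|_]; rewrite ?orbT ?orbF ?andNb.
    case=> -[a b] /= [ha hb ->]; move: ha hb; rewrite !mem_permutations => ha hb.
    have sa : size a = k by rewrite (perm_size ha) -cardE.
    rewrite take_size_cat //; split.
      by apply/eqP/setP => x; rewrite inE (perm_mem ha) mem_enum.
    apply: (@perm_trans _ (enum S ++ enum (M :\: S))); first exact: perm_cat.
    apply: uniq_perm; rewrite ?enum_uniq //.
      rewrite cat_uniq !enum_uniq andbT /=; apply/hasPn => x; rewrite !mem_enum inE => /andP[].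
      by [].
    move=> x; rewrite mem_cat !mem_enum inE.
    by case: (boolP (x \in S)) => //= /(fintype.subsetP SM) ->.
rewrite (perm_size pe) size_allpairs !size_permutations ?enum_uniq // -!cardE Sk.
by rewrite cardsD (finset.setIidPr SM) Sk.
Qed.

Lemma sum_orderings M k (f : {set T} -> nat) : k <= #|M| ->
  \sum_(s <- permutations (enum M)) f [set:: drop k s] =
  (\sum_(S in powerset M | #|S| == k) f (M :\: S)) * (k`! * (#|M| - k)`!).
Proof.
move=> kM.
have sP s : s \in permutations (enum M) ->
    [/\ [set:: take k s] \subset M, #|[set:: take k s]| = k & [set:: drop k s] = M :\: [set:: take k s]].
  rewrite mem_permutations => sM; have us : uniq s by rewrite (perm_uniq sM) enum_uniq.
  split.
  - by apply/fintype.subsetP => x; rewrite inE => /mem_take; rewrite (perm_mem sM) mem_enum.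
  - rewrite cardsE (card_uniqP _) ?take_uniq // size_takel //.
    by rewrite (perm_size sM) -cardE.
  - apply/setP => x; rewrite !inE -(mem_enum M) -(perm_mem sM) -{3}(cat_take_drop k s) mem_cat.
    move: us; rewrite -{1}(cat_take_drop k s) cat_uniq => /and3P[_ /hasPn h _].
    by case: (boolP (x \in drop k s)) => [/h ->|_]; rewrite ?orbT ?orbF ?andNb.
rewrite big_seq (partition_big (fun s => [set:: take k s]) (fun S => (S \in powerset M) && (#|S| == k))); last first.
  by move=> s /sP[h1 h2 _]; rewrite powersetE h1 h2 eqxx.
rewrite big_distrl /=; apply: eq_bigr => S /andP[]; rewrite powersetE => SM /eqP Sk.
rewrite -(count_orderings_prefix SM Sk) -sum1_count big_distrr /= -big_seq_cond.
rewrite [RHS]big_seq_cond [LHS]big_seq_cond; apply: eq_bigr => s /andP[/sP[_ _ ->] /eqP ->].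
by rewrite muln1.
Qed.
End Orderings.

Section Graph.
Variables (n : nat) (d : 'I_n -> nat).
Let tg : half_edge d -> 'I_n := tag.
Implicit Types (E M S : {set {set half_edge d}}).

(** The vertices that can be reached from a given one form a set that no edge
    crosses. *)
Lemma connected_graphE E : (forall e, e \in E -> #|e| = 2) ->
  connected_graph E = spans tg [set: 'I_n] E.
Proof.
move=> E2; apply/idP/idP => [/forallP conn|sp].
  apply/forallP => U; apply/implyP => sU.
  have clU : fingraph.closed (adjacent_in E) U.
    move=> u v /existsP[h /existsP[h' /and3P[/eqP <- /eqP <- hE]]].
    by have := forall_inP sU _ hE; rewrite pair_saturated !inE => /eqP.
  case: (finset.set_0Vmem U) => [->|[u uU]].
    by rewrite -finset.setI_eq0 finset.set0I eqxx.
  apply/orP; right; apply/fintype.subsetP => v _.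
  by rewrite -(closed_connect clU (forallP (conn u) v)).
apply/forallP => u; apply/forallP => v.
have asym : connect_sym (adjacent_in E).
  apply: sym_connect_sym => x y; apply/existsP/existsP => -[h /existsP[h' /and3P[p q r]]];
  by exists h'; apply/existsP; exists h; rewrite p q finset.setUC r.
have /implyP := forallP sp [set w | connect (adjacent_in E) u w].
have -> : saturated E (tg @^-1: [set w | connect (adjacent_in E) u w]).
  apply/forall_inP => e eE; have /eqP/cards2P[h [h' [_ Ee]]] := E2 _ eE.
  rewrite Ee pair_saturated !inE; apply/eqP.
  have adj : connect (adjacent_in E) (tg h) (tg h').
    by apply: connect1; apply/existsP; exists h; apply/existsP; exists h'; rewrite !eqxx -Ee.
  by apply/idP/idP => /connect_trans; apply; rewrite // asym.
move=> /(_ isT)/orP[|/fintype.subsetP/(_ v)]; last by rewrite !inE => ->.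
by rewrite -finset.setI_eq0 finset.setIT => /eqP/setP/(_ u); rewrite !inE connect0.
Qed.

Lemma pairingsE : pairings d = matchings (tg @^-1: [set: 'I_n]).
Proof. by rewrite finset.preimsetT. Qed.

Lemma card_half_edges : #|tg @^-1: [set: 'I_n]| = degree_sum d.
Proof.
rewrite finset.preimsetT cardsT card_tagged sumnE big_map big_enum /=.
by apply: eq_bigr => v _; rewrite card_ord.
Qed.

Lemma degreeE v : degree tg v = d v.
Proof.
rewrite /degree -[RHS](card_ord (d v)) -cardsT.
rewrite -(card_imset (f := Tagged (fun w => 'I_(d w)))); last exact: eq_from_Tagged.
apply: eq_card => h; rewrite !inE; apply/eqP/imsetP => [<-|[i _ ->] //].
by exists (tagged h); rewrite ?inE ?taggedK.
Qed.

(** Disconnection is permanent, so only the graph after [k] removals matters. *)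
Lemma disconnection_time_gt M s k : M \in pairings d -> perm_eq s (enum M) ->
  k <= size s ->
  (k < disconnection_time s) = spans tg [set: 'I_n] [set:: drop k s].
Proof.
move=> MP sM ks.
have sub2 j e : e \in [set:: drop j s] -> #|e| = 2.
  rewrite inE => /mem_drop; rewrite (perm_mem sM) mem_enum.
  by move: MP; rewrite pairingsE => /matchingP[_ _]; apply.
rewrite /disconnection_time; set a := (fun k => ~~ _); set l := iota _ _.
apply/idP/idP => [h|sp].
  have := before_find 0 h; rewrite nth_iota ?ltnS // add0n /a => /negbFE.
  by rewrite connected_graphE //; exact: sub2.
rewrite ltnNge; apply/negP => h.
have hs : has a l by rewrite has_find size_iota ltnS (leq_trans h).
have := nth_find 0 hs; rewrite nth_iota ?ltnS ?(leq_trans h) // add0n /a.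
rewrite connected_graphE; last exact: sub2.
move/negP; apply; apply: spans_sub sp.
apply/fintype.subsetP => e; rewrite !inE -[X in drop X](subnK h) -drop_drop.
by move/mem_drop.
Qed.

Local Open Scope ring_scope.
Variable R : realType.

(** The first [k] edges of a uniform ordering form a uniform [k]-subset, and
    [survivals _ 0] is the number of connected pairings, to which the law is
    conditioned. *)
Lemma prob_T_survivals k : ~~ odd (degree_sum d) ->
  (k <= num_edges d)%N -> (0 < survivals tg [set: 'I_n] 0)%N ->
  prob_T d R (fun t => t <= k)%N =
  1 - (survivals tg [set: 'I_n] k)%:R / (survivals tg [set: 'I_n] 0 * 'C(num_edges d, k))%:R.
Proof.
move=> ev km N0; set m := num_edges d in km *; set N := survivals tg _ 0 in N0 *.
have cardM M : M \in pairings d -> #|M| = m.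
  rewrite pairingsE => /card_matching; rewrite card_half_edges /m /num_edges => ->.
  by rewrite muln2 doubleK.
have P0 : #|pairings d|%:R != 0 :> R.
  rewrite pnatr_eq0 -lt0n (leq_trans N0) // /N survivals0 -pairingsE subset_leq_card //.
  by apply/fintype.subsetP => M; rewrite [M \in [set _ in _ | _]]finset.in_set => /andP[].
have pairs2 M : M \in pairings d -> forall e, e \in M -> #|e| = 2.
  by rewrite pairingsE => /matchingP[_ _].
have NE : N%:R = \sum_(M in pairings d) (spans tg [set: 'I_n] M)%:R :> R.
  rewrite /N survivals0 -pairingsE -sum1_card natr_sum big_mkcond [RHS]big_mkcond /=.
  apply: eq_bigr => M _; rewrite [M \in [set _ in _ | _]]finset.in_set.
  by case: (M \in pairings d) => //=; case: spans.
have den : \sum_(M' : {set {set half_edge d}} | connected_graph M') CM R M' = N%:R / #|pairings d|%:R.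
  rewrite NE mulr_suml big_mkcond [RHS]big_mkcond /=; apply: eq_bigr => M _.
  rewrite /CM; case: (boolP (M \in pairings d)) => [MP|_]; last by rewrite mul0r if_same.
  by rewrite connected_graphE //; [case: spans; rewrite ?mul0r | exact: pairs2].
have N0' : N%:R != 0 :> R by rewrite pnatr_eq0 -lt0n.
have CMc M : CM_connected R M = (M \in pairings d)%:R * (spans tg [set: 'I_n] M)%:R / N%:R.
  rewrite /CM_connected den /CM; case: (boolP (M \in pairings d)) => [MP|_]; last first.
    by rewrite !mul0r if_same mul0r.
  rewrite connected_graphE; last exact: pairs2.
  case: spans => /=; last by rewrite mulr0 !mul0r.
  by field; rewrite P0 N0'.
have fact0 i : i`!%:R != 0 :> R by rewrite pnatr_eq0 -lt0n fact_gt0.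
have Cf : 'C(m, k)%:R * (k`! * (m - k)`!)%:R = m`!%:R :> R by rewrite -natrM bin_fact.
have C0 : 'C(m, k)%:R != 0 :> R by rewrite pnatr_eq0 -lt0n bin_gt0.
pose g M : nat := (\sum_(S in powerset M | #|S| == k) spans tg [set: 'I_n] (M :\: S))%N.
rewrite /prob_T.
transitivity (\sum_(M in pairings d) (spans tg [set: 'I_n] M)%:R / N%:R * (1 - (g M)%:R / 'C(m, k)%:R) : R).
  rewrite [RHS]big_mkcond /=; apply: eq_bigr => M _; rewrite CMc.
  case: (boolP (M \in pairings d)) => [MP|_]; last by rewrite !mul0r.
  rewrite mul1r; congr (_ * _).
  have orders : \sum_(s <- permutations (enum M)) (disconnection_time s <= k)%N%:R =
      m`!%:R - (g M * (k`! * (m - k)`!))%:R :> R.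
    have := @sum_orderings _ M k (fun E => spans tg [set: 'I_n] E); rewrite (cardM _ MP) => /(_ km).
    rewrite -/(g M) => <-; rewrite natr_sum.
    have -> : m`!%:R = \sum_(s <- permutations (enum M)) 1 :> R.
      by rewrite big_const_seq count_predT size_permutations ?enum_uniq // -cardE (cardM _ MP) iter_addr_0.
    rewrite -sumrB big_seq [RHS]big_seq; apply: eq_bigr => s; rewrite mem_permutations => sM.
    rewrite -(disconnection_time_gt MP sM); last by rewrite (perm_size sM) -cardE (cardM _ MP).
    by rewrite ltnNge; case: (_ <= _)%N; rewrite /= ?subr0 ?subrr.
  rewrite size_permutations ?enum_uniq // -cardE (cardM _ MP) orders natrM -Cf.
  by field; rewrite ?C0 ?fact0.
have gE M : M \in pairings d -> (spans tg [set: 'I_n] M)%:R * (g M)%:R = (g M)%:R :> R.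
  move=> MP; case: (boolP (spans tg [set: 'I_n] M)) => [_|ns]; first by rewrite mul1r.
  rewrite mul0r /g big1 // => S _; case: (boolP (spans _ _ _)) => // /(spans_sub (finset.subsetDl M S)).
  by rewrite (negPf ns).
transitivity (\sum_(M in pairings d) ((spans tg [set: 'I_n] M)%:R / N%:R - (g M)%:R / (N%:R * 'C(m, k)%:R)) : R).
  apply: eq_bigr => M MP; rewrite mulrBr mulr1 -{2}(gE M MP); congr (_ - _).
  by field; rewrite N0' C0.
rewrite sumrB -!mulr_suml -NE divff // natrM; congr (_ - _ / _).
rewrite -natr_sum survivalsE -pairingsE; congr (_%:R); apply: eq_bigr => M _.
rewrite /g big_mkcondr /=; apply: eq_bigr => S _.
by case: eqP => _; rewrite ?andbT ?andbF.
Qed.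

End Graph.

Local Open Scope ring_scope.

(** * The chance that no path is hit twice *)

Section Asymptotics.
Local Open Scope classical_set_scope.
Local Open Scope ring_scope.
Variable R : realType.

(** The probability that [k] edges chosen uniformly lie on [k] different paths
    when [m] edges are distributed over [m'] nonempty paths by a uniform
    composition: a birthday problem. *)
Definition no_repeat_prob (m m' k : nat) : R :=
  \prod_(i < k) ((m + i)%:R * (m' - i)%:R / ((m' + i)%:R * (m - i)%:R)).

Lemma telescope_shift (c l : nat) :
  ((\prod_(j < l) (c + 2 * j + 2)) * c = (\prod_(j < l) (c + 2 * j)) * (c + 2 * l))%N.
Proof.
elim: l => [|l IH]; first by rewrite !big_ord0 muln0 addn0.
rewrite !big_ord_recr /= mulnAC IH -!mulnA; congr (_ * _)%N; lia.
Qed.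

(** In both products over [j] the factors advance by steps of two, so raising
    [k] by one changes their ratio by a telescoping factor. *)
Lemma no_repeat_probE (m m' k : nat) : (0 < m')%N -> (m' <= m)%N -> (k <= m')%N ->
  (\prod_(j < m - m') (2 * m' + 2 * j + 2 * k))%:R * 'C(m', k)%:R =
  no_repeat_prob m m' k * ((\prod_(j < m - m') (2 * m' + 2 * j + 2 * 0))%:R * 'C(m, k)%:R) :> R.
Proof.
move=> m0 mm; elim: k => [|k IH] km; first by rewrite /no_repeat_prob big_ord0 mul1r !bin0.
have {IH} := IH (ltnW km); rewrite /no_repeat_prob big_ord_recr /=.
set Q := \prod_(i < k) _; set P0 := (\prod_(j < _) (_ + 2 * 0))%N.
set Pk := (\prod_(j < _) (_ + 2 * k))%N; set Pk1 := (\prod_(j < _) (_ + 2 * k.+1))%N.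
have tel : (Pk1 * (m' + k) = Pk * (m + k))%N.
  have := telescope_shift (2 * m' + 2 * k) (m - m').
  have -> : (\prod_(j < m - m') (2 * m' + 2 * k + 2 * j + 2) = Pk1)%N.
    by apply: eq_bigr => j _; lia.
  have -> : (\prod_(j < m - m') (2 * m' + 2 * k + 2 * j) = Pk)%N.
    by apply: eq_bigr => j _; lia.
  have -> : (2 * m' + 2 * k + 2 * (m - m') = 2 * (m + k))%N by lia.
  by rewrite -mulnDr !(mulnCA _ 2) => /eqP; rewrite eqn_pmul2l // => /eqP.
have b1 := mul_bin_left m' k; have b2 := mul_bin_left m k.
have f (a b : nat) : a = b -> a%:R = b%:R :> R by move=> ->.
have := f _ _ tel; have := f _ _ b1; have := f _ _ b2.
rewrite !natrM => {}b2 {}b1 {}tel.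
have n1 : (m' + k)%:R != 0 :> R by rewrite pnatr_eq0; lia.
have n2 : (m - k)%:R != 0 :> R by rewrite pnatr_eq0; lia.
have n3 : k.+1%:R != 0 :> R by rewrite pnatr_eq0.
move=> IH; apply: (mulIf n1); apply: (mulIf n3).
transitivity ((Pk1%:R * (m' + k)%:R) * (k.+1%:R * 'C(m', k.+1)%:R) : R); first by ring.
rewrite tel b1.
transitivity ((Pk%:R * 'C(m', k)%:R) * ((m + k)%:R * (m' - k)%:R) : R); first by ring.
rewrite IH.
transitivity (Q * P0%:R * ((m + k)%:R * (m' - k)%:R) / (m - k)%:R * ((m - k)%:R * 'C(m, k)%:R) : R).
  by field.
by rewrite -b2; field; rewrite -?natrD ?n1 ?n2.
Qed.

Lemma sum_ord_double k : \sum_(i < k) (2 * i%:R) = k%:R * (k%:R - 1) :> R.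
Proof.
elim: k => [|k IH]; first by rewrite big_ord0 mul0r.
by rewrite big_ord_recr /= IH -natr1; ring.
Qed.

(** A factor of [no_repeat_prob] and its inverse are [1 - u] and [1 + v] with
    explicit nonnegative [u] and [v] close to [2 * i * (m - m') / (m * m')];
    both bounds follow from the inequality [1 + t <= expR t]. *)
Lemma no_repeat_prob_bounds (m m' k : nat) : (m' <= m)%N -> (k < m')%N ->
  expR (- (k%:R * (k%:R - 1) * (m - m')%:R / (m%:R * (m' - k)%:R)))
    <= no_repeat_prob m m' k <=
  expR (- (k%:R * (k%:R - 1) * (m - m')%:R / (m%:R * (m' + k)%:R))).
Proof.
move=> mm km.
have fact i : (i < k)%N -> [/\ (m + i)%:R = m%:R + i%:R :> R, (m' - i)%:R = m'%:R - i%:R :> R,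
    (m' + i)%:R = m'%:R + i%:R :> R & (m - i)%:R = m%:R - i%:R :> R].
  move=> ik; have im : (i <= m)%N by lia.
  have im' : (i <= m')%N by lia.
  by rewrite !natrD !natrB.
have aE : (m - m')%:R = m%:R - m'%:R :> R by rewrite natrB.
have pos i : (i < k)%N -> [/\ 0 < (m + i)%:R :> R, 0 < (m' - i)%:R :> R, 0 < (m' + i)%:R :> R & 0 < (m - i)%:R :> R].
  by move=> ik; split; rewrite ltr0n; lia.
apply/andP; split.
- apply: (@le_trans _ _ (\prod_(i < k) expR (- (2 * i%:R * (m - m')%:R / (m%:R * (m' - k)%:R))))).
    by rewrite -expR_sum sumrN -!mulr_suml sum_ord_double.
  apply: ler_prod => i _; rewrite expR_ge0 /=; have ik := ltn_ord i.
  have [p1 p2 p3 p4] := pos _ ik.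
  rewrite expRN -lef_pV2 ?posrE ?invr_gt0 ?expR_gt0 ?divr_gt0 ?mulr_gt0 // invrK.
  apply: le_trans (expR_ge1Dx _).
  have -> : ((m + i)%:R * (m' - i)%:R / ((m' + i)%:R * (m - i)%:R))^-1 =
    1 + 2 * i%:R * (m - m')%:R / ((m + i)%:R * (m' - i)%:R) :> R.
    have [E1 E2 E3 E4] := fact _ ik.
    rewrite E1 E2 E3 E4 aE in p1 p2 p3 p4 *.
    by field; rewrite !gt_eqF.
  rewrite lerD2l ler_wpM2l ?mulr_ge0 // lef_pV2 ?posrE ?mulr_gt0 // ?ltr0n; [|lia|lia].
  by rewrite -!natrM ler_nat leq_mul; lia.
- apply: (@le_trans _ _ (\prod_(i < k) expR (- (2 * i%:R * (m - m')%:R / (m%:R * (m' + k)%:R))))); last first.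
    by rewrite -expR_sum sumrN -!mulr_suml sum_ord_double.
  apply: ler_prod => i _; have ik := ltn_ord i.
  have [p1 p2 p3 p4] := pos _ ik.
  rewrite divr_ge0 ?mulr_ge0 //=; apply: le_trans (expR_ge1Dx _).
  have -> : ((m + i)%:R * (m' - i)%:R / ((m' + i)%:R * (m - i)%:R)) =
    1 - 2 * i%:R * (m - m')%:R / ((m - i)%:R * (m' + i)%:R) :> R.
    have [E1 E2 E3 E4] := fact _ ik.
    rewrite E1 E2 E3 E4 aE in p1 p2 p3 p4 *.
    by field; rewrite !gt_eqF.
  rewrite lerD2l lerN2 ler_wpM2l ?mulr_ge0 // lef_pV2 ?posrE ?mulr_gt0 // ?ltr0n; [|lia|lia].
  by rewrite -!natrM ler_nat leq_mul; lia.
Qed.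

Lemma sqrt_inv_cvg0 (m : nat -> nat) : ((m n)%:R : R) @[n --> \oo] --> +oo ->
  (Num.sqrt (m n)%:R)^-1 @[n --> \oo] --> (0 : R).
Proof.
move=> /cvgryPgt mo; apply/gtr0_cvgV0.
  by apply: filterS (mo 0) => n m0; rewrite sqrtr_gt0.
apply/cvgryPge => A; apply: filterS (mo (A ^+ 2)) => n mA.
have [A0|A0] := leP 0 A; last by rewrite (le_trans (ltW A0)) // sqrtr_ge0.
by rewrite -[A]ger0_norm // -sqrtr_sqr ler_wsqrtr // ltW.
Qed.

Lemma truncn_sqrt_cvg (m : nat -> nat) (x : R) : 0 <= x ->
  ((m n)%:R : R) @[n --> \oo] --> +oo ->
  (Num.truncn (x * Num.sqrt (m n)%:R))%:R / Num.sqrt (m n)%:R @[n --> \oo] --> x.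
Proof.
move=> x0 mo; have v0 := sqrt_inv_cvg0 mo.
apply: (@squeeze_cvgr _ _ _ _ (fun n => x - (Num.sqrt (m n)%:R)^-1) (fun=> x)); last exact: cvg_cst.
  move/cvgryPgt : mo => /(_ 0); apply: filterS => n m0.
  have s0 : 0 < Num.sqrt (m n)%:R :> R by rewrite sqrtr_gt0.
  have /truncn_itv/andP[t1 t2] : 0 <= x * Num.sqrt (m n)%:R by rewrite mulr_ge0 // ltW.
  rewrite ler_pdivlMr // ler_pdivrMr // mulrBl mulVf ?gt_eqF // t1 andbT.
  by rewrite lerBlDr natr1 ltW.
by rewrite -[X in _ --> X]subr0; apply: cvgB => //; exact: cvg_cst.
Qed.

(** As [k n] is of order the square root of [m n], both exponents in
    [no_repeat_prob_bounds] converge to the same limit. *)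
Lemma no_repeat_prob_cvg (m m' : nat -> nat) (b x : R) : 0 <= x ->
  (\forall n \near \oo, (m' n <= m n)%N) ->
  ((m' n)%:R : R) @[n --> \oo] --> +oo ->
  (m n - m' n)%:R / (m' n)%:R @[n --> \oo] --> b ->
  let k n := Num.truncn (x * Num.sqrt (m n)%:R) in
  ((k n)%:R / (m' n)%:R @[n --> \oo] --> (0 : R)) /\
  (no_repeat_prob (m n) (m' n) (k n) @[n --> \oo] --> expR (- (x ^+ 2 * b))).
Proof.
move=> x0 mm m'o Bb k.
have mo : ((m n)%:R : R) @[n --> \oo] --> +oo.
  apply/cvgryPge => A; move/cvgryPge : m'o => /(_ A) h.
  by apply: filterS2 mm h => n mmn h; rewrite (le_trans h) // ler_nat.
have v0 := sqrt_inv_cvg0 mo; have ux := truncn_sqrt_cvg x0 mo.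
pose v n : R := (Num.sqrt (m n)%:R)^-1.
pose u n : R := (k n)%:R / Num.sqrt (m n)%:R.
pose B n : R := (m n - m' n)%:R / (m' n)%:R.
have m'pos : \forall n \near \oo, (0 < m' n)%N.
  by move/cvgryPgt : m'o => /(_ 0); apply: filterS => n; rewrite ltr0n.
have tE : \forall n \near \oo, u n * v n * (1 + B n) = (k n)%:R / (m' n)%:R.
  apply: filterS2 mm m'pos => n mmn m'0; rewrite /u /v /B natrB //.
  have m0 : 0 < (m n)%:R :> R by rewrite ltr0n (leq_trans m'0).
  have s0 : 0 < Num.sqrt (m n)%:R :> R by rewrite sqrtr_gt0.
  have sq : Num.sqrt (m n)%:R * Num.sqrt (m n)%:R = (m n)%:R :> R by rewrite -expr2 sqr_sqrtr // ltW.
  have m'0' : (m' n)%:R != 0 :> R by rewrite pnatr_eq0 -lt0n.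
  transitivity ((k n)%:R / (Num.sqrt (m n)%:R * Num.sqrt (m n)%:R) * ((m n)%:R / (m' n)%:R) : R).
    by field; rewrite m'0' gt_eqF.
  by rewrite sq; field; rewrite m'0' gt_eqF.
have t0 : (k n)%:R / (m' n)%:R @[n --> \oo] --> (0 : R).
  apply: cvg_trans; first by apply: near_eq_cvg; apply: filterS tE => n <-; reflexivity.
  have -> : 0 = x * 0 * (1 + b) by rewrite mulr0 mul0r.
  by apply: cvgM; [exact: cvgM|apply: cvgD => //; exact: cvg_cst].
split=> //.
have km : \forall n \near \oo, (k n < m' n)%N.
  have /cvgr_lt/(_ 1 ltr01) := t0; apply: filterS2 m'pos => n m'0.
  by rewrite ltr_pdivrMr ?ltr0n // mul1r ltr_nat.
have numer : (u n ^+ 2 - u n * v n) * B n @[n --> \oo] --> x ^+ 2 * b.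
  have -> : x ^+ 2 * b = (x ^+ 2 - x * 0) * b by rewrite mulr0 subr0.
  by apply: cvgM => //; apply: cvgB; [exact: cvgM|exact: cvgM].
have up : expR (- ((u n ^+ 2 - u n * v n) * B n / (1 - (k n)%:R / (m' n)%:R))) @[n --> \oo] --> expR (- (x ^+ 2 * b)).
  apply: (@continuous_cvg _ _ _ _ _ _ expR); first exact: continuous_expR.
  apply: cvgN; have -> : x ^+ 2 * b = x ^+ 2 * b / (1 - 0) by rewrite subr0 divr1.
  apply: cvgM => //; apply: cvgV; first by rewrite subr0 oner_eq0.
  by apply: cvgB => //; exact: cvg_cst.
have down : expR (- ((u n ^+ 2 - u n * v n) * B n / (1 + (k n)%:R / (m' n)%:R))) @[n --> \oo] --> expR (- (x ^+ 2 * b)).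
  apply: (@continuous_cvg _ _ _ _ _ _ expR); first exact: continuous_expR.
  apply: cvgN; have -> : x ^+ 2 * b = x ^+ 2 * b / (1 + 0) by rewrite addr0 divr1.
  apply: cvgM => //; apply: cvgV; first by rewrite addr0 oner_eq0.
  by apply: cvgD => //; exact: cvg_cst.
apply: squeeze_cvgr up down; apply: filterS2 mm km => n mmn kmn.
have := no_repeat_prob_bounds mmn kmn.
have m'0 : 0 < (m' n)%:R :> R by rewrite ltr0n (leq_ltn_trans _ kmn).
have m0 : 0 < (m n)%:R :> R by apply: lt_le_trans m'0 _; rewrite ler_nat.
have s0 : 0 < Num.sqrt (m n)%:R :> R by rewrite sqrtr_gt0.
have sq : (m n)%:R = Num.sqrt (m n)%:R ^+ 2 :> R by rewrite sqr_sqrtr // ltW.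
have d0 : 0 < (m' n)%:R - (k n)%:R :> R by rewrite subr_gt0 ltr_nat.
have d1 : 0 < (m' n)%:R + (k n)%:R :> R by rewrite ltr_pwDl.
rewrite natrD (natrB _ (ltnW kmn)).
have -> : (k n)%:R * ((k n)%:R - 1) * (m n - m' n)%:R / ((m n)%:R * ((m' n)%:R - (k n)%:R)) =
   (u n ^+ 2 - u n * v n) * B n / (1 - (k n)%:R / (m' n)%:R) :> R.
  rewrite /u /v /B; move: (m n - m' n)%:R => z; move: s0 sq.
  set r := Num.sqrt _ => s0 ->.
  by field; rewrite !gt_eqF.
have -> : (k n)%:R * ((k n)%:R - 1) * (m n - m' n)%:R / ((m n)%:R * ((m' n)%:R + (k n)%:R)) =
   (u n ^+ 2 - u n * v n) * B n / (1 + (k n)%:R / (m' n)%:R) :> R.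
  rewrite /u /v /B; move: (m n - m' n)%:R => z; move: s0 sq.
  set r := Num.sqrt _ => s0 ->.
  by field; rewrite !gt_eqF.
by [].
Qed.

End Asymptotics.

(** * Reduction of the configuration model to its kernel *)

Lemma matchings_gt0 (H : finType) (X : {set H}) j :
  #|X| = (2 * j)%N -> (0 < #|matchings X|)%N.
Proof.
elim: j X => [|j IH] X EX.
  apply/card_gt0P; exists finset.set0; move: EX => /eqP; rewrite muln0 cards_eq0 => /eqP ->.
  apply/matchingP; split; first by rewrite /finset.cover big_set0.
    by apply/finset.trivIsetP => A B; rewrite inE.
  by move=> e; rewrite inE.
have /card_gt0P[a aX] : (0 < #|X|)%N by rewrite EX.
have ca := cardsD1 a X; rewrite aX EX in ca.
have /card_gt0P[x xX] : (0 < #|X :\ a|)%N by lia.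
have cx := cardsD1 x (X :\ a); rewrite xX in cx.
have EX' : X :\: [set a; x] = X :\ a :\ x by rewrite finset.setDDl.
have /IH/card_gt0P[M MX] : #|X :\: [set a; x]| = (2 * j)%N by rewrite EX'; lia.
apply/card_gt0P; exists ([set a; x] |: M).
case/setD1P: xX cx => xa xX cx.
rewrite matchingU1 //.
- by rewrite finset.subUset !finset.sub1set aX.
- by rewrite cards2 eq_sym xa.
- apply/negP => /(matching_edge MX)/fintype.subsetP/(_ a (set21 _ _)).
  by rewrite !inE eqxx.
Qed.

Section OneGraph.
Variables (n : nat) (d : 'I_n -> nat).
Let tg : half_edge d -> 'I_n := tag.
Hypothesis d_even : ~~ odd (degree_sum d).
Hypothesis d0 : num_deg d 0 = 0%N.
Hypothesis d1 : num_deg d 1 = 0%N.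

Definition kernel_vertices : {set 'I_n} := [set v | (2 < d v)%N].
Definition kernel_size : nat := (num_edges d - num_deg d 2)%N.

Lemma degree_ge2 v : (2 <= d v)%N.
Proof.
move/eqP: d0; rewrite cards_eq0 => /eqP/setP/(_ v); rewrite !inE => v0.
move/eqP: d1; rewrite cards_eq0 => /eqP/setP/(_ v); rewrite !inE => v1.
lia.
Qed.

Lemma degree_sumE : degree_sum d = (2 * num_deg d 2 + \sum_(v in kernel_vertices) d v)%N.
Proof.
rewrite /degree_sum (bigID (mem kernel_vertices)) /= addnC; congr addn.
rewrite (eq_bigr (fun=> 2%N)) => [|v]; last first.
  by rewrite inE -leqNgt => v2; have := degree_ge2 v; lia.
rewrite sum_nat_const mulnC; congr (2 * _)%N; apply: eq_card => v.
by rewrite !inE [LHS]unfold_in inE; have := degree_ge2 v; lia.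
Qed.

Lemma card_kernel_halves : #|tg @^-1: kernel_vertices| = (2 * kernel_size)%N.
Proof.
have -> : #|tg @^-1: kernel_vertices| = \sum_(v in kernel_vertices) d v.
  by rewrite card_preimset_sum; apply: eq_bigr => v _; rewrite degreeE.
rewrite /kernel_size /num_edges; have := degree_sumE; have := even_halfK d_even.
by move: (degree_sum d) (num_deg d 2) (\sum_(v in _) _)%N => S N T; lia.
Qed.

Lemma num_deg2_le : (num_deg d 2 <= num_edges d)%N.
Proof.
rewrite /num_edges; have := degree_sumE; have := even_halfK d_even.
by move: (degree_sum d) (num_deg d 2) (\sum_(v in _) _)%N => S N T; lia.
Qed.

Lemma degree_sum_ge : (3 * n <= degree_sum d + num_deg d 2)%N.
Proof.
have -> : num_deg d 2 = (\sum_(v < n) (d v == 2))%N.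
  by rewrite /num_deg -sum1_card big_mkcond; apply: eq_bigr => v _; rewrite inE.
rewrite /degree_sum -big_split /= -[X in (3 * X <= _)%N]card_ord mulnC -sum_nat_const.
by apply: leq_sum => v _; have := degree_ge2 v; case: eqP; lia.
Qed.

Lemma survivals_kernel k : kernel_vertices != finset.set0 ->
  survivals tg [set: 'I_n] k =
  (\prod_(j < num_edges d - kernel_size) (2 * kernel_size + 2 * j + 2 * k) * survivals tg kernel_vertices k)%N.
Proof.
move=> W0; pose D := [set v | d v == 2].
have -> : [set: 'I_n] = D :|: kernel_vertices.
  by apply/setP => v; rewrite !inE; have := degree_ge2 v; lia.
have -> : (num_edges d - kernel_size)%N = #|D|.
  by rewrite /kernel_size subKn // num_deg2_le.
rewrite survivals_contractn ?card_kernel_halves //.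
- rewrite -finset.setI_eq0; apply/eqP/setP => v; rewrite !inE; lia.
- by move=> v; rewrite inE degreeE => /eqP.
Qed.

Variable R : realType.

(** Suppressing all vertices of degree two, both with and without removals,
    factors the survival probability into [no_repeat_prob] and the survival
    probability of the kernel, which lies between [1 - eta] and 1. The
    hypothesis at [j = 0] serves to show that connected pairings exist. *)
Lemma prob_T_bounds (k : nat) (eta : R) : 0 <= eta -> eta < 1 ->
  (0 < kernel_size)%N -> (k <= kernel_size)%N ->
  (forall j, (j == 0) || (j == k) ->
    (#|matchings (tg @^-1: kernel_vertices)| * 'C(kernel_size, j))%:R * (1 - eta)
    <= (survivals tg kernel_vertices j)%:R) ->
  (1 - eta) * no_repeat_prob R (num_edges d) kernel_size k
    <= 1 - prob_T d R (fun t => t <= k)%N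
    <= no_repeat_prob R (num_edges d) kernel_size k.
Proof.
move=> e0 e1 m0 km low.
set m := num_edges d; set m' := kernel_size in m0 km low *.
have mm : (m' <= m)%N by exact: leq_subr.
have e1' : 0 < 1 - eta by rewrite subr_gt0.
have W0 : kernel_vertices != finset.set0.
  apply: contraTneq m0 => W0; have := card_kernel_halves.
  by rewrite W0 finset.preimset0 cards0 -/m' => /eqP; rewrite eq_sym muln_eq0 /= => /eqP ->.
have M0 := matchings_gt0 card_kernel_halves; rewrite -/m' in M0.
set a0 := survivals tg kernel_vertices 0; set ak := survivals tg kernel_vertices k.
have a0_gt0 : 0 < a0%:R :> R.
  apply: lt_le_trans (low 0%N _); last by rewrite eqxx.
  by rewrite mulr_gt0 // bin0 muln1 ltr0n.
have a0n : (0 < a0)%N by rewrite -(ltr0n R).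
have Em' : (#|tg @^-1: kernel_vertices|./2 = m')%N by rewrite card_kernel_halves mul2n doubleK.
have ak_le : (ak <= a0 * 'C(m', k))%N by have := survivals_le tg kernel_vertices k; rewrite Em'.
have a0_le : (a0 <= #|matchings (tg @^-1: kernel_vertices)|)%N.
  by have := survivals_le_total tg kernel_vertices 0; rewrite bin0 muln1.
have Ck : 0 < 'C(m', k)%:R :> R by rewrite ltr0n bin_gt0.
have Cmk : 0 < 'C(m, k)%:R :> R by rewrite ltr0n bin_gt0 (leq_trans km).
rewrite prob_T_survivals //; last 2 first.
- exact: leq_trans km mm.
- rewrite survivals_kernel // muln_gt0 -/a0 a0n andbT.
  by apply: prodn_gt0 => j; rewrite -/m'; lia.
rewrite subKr !survivals_kernel // -/m -/m' -/ak -/a0 !natrM.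
have := @no_repeat_probE R m m' k m0 mm km.
set Pk := (\prod_(_ < _) _)%N; set P0 := (\prod_(_ < _) _)%N; set Q := no_repeat_prob _ _ _ _ => EQ.
have P0_gt0 : 0 < P0%:R :> R by rewrite ltr0n; apply: prodn_gt0 => j; lia.
have -> : Pk%:R * ak%:R / (P0%:R * a0%:R * 'C(m, k)%:R) = Q * (ak%:R / (a0%:R * 'C(m', k)%:R)).
  have -> : Pk%:R = Q * (P0%:R * 'C(m, k)%:R) / 'C(m', k)%:R by rewrite -EQ mulfK // gt_eqF.
  by field; rewrite !gt_eqF.
have Q0 : 0 <= Q.
  by apply: prodr_ge0 => i _; rewrite divr_ge0 ?mulr_ge0.
have low_k := low k; rewrite eqxx orbT in low_k.
apply/andP; split.
  rewrite mulrC ler_wpM2l // ler_pdivlMr ?mulr_gt0 //.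
  apply: le_trans (low_k isT); rewrite mulrC ler_wpM2r ?(ltW e1') // natrM ler_wpM2r ?(ltW Ck) //.
  by rewrite ler_nat.
rewrite -[X in _ <= X]mulr1 ler_wpM2l // ler_pdivrMr ?mulr_gt0 // mul1r -natrM ler_nat.
by [].
Qed.

End OneGraph.

Local Open Scope classical_set_scope.
Local Open Scope ring_scope.

(** * The Rayleigh law *)

Definition rayleigh_pdf {R : realType} (c x : R) : R :=
  if 0 <= x then 2 * c * x * expR (- (c * x ^+ 2)) else 0.

Definition rayleigh_prob {R : realType} (c : R) (A : set (measurableTypeR R)) : \bar R :=
  (\int[lebesgue_measure]_(x in A) (rayleigh_pdf c x)%:E)%E.

Section Rayleigh.
Variables (R : realType) (c : R).
Hypothesis c_gt0 : 0 < c.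

Lemma rayleigh_pdf_ge0 x : 0 <= rayleigh_pdf c x.
Proof.
rewrite /rayleigh_pdf; case: ifP => // x0.
by rewrite !mulr_ge0 ?expR_ge0 // ltW.
Qed.

Let primitive (x : R) : R := - expR (- (c * x ^+ 2)).

Let primitive_derive (x : R) : is_derive x 1 primitive (2 * c * x * expR (- (c * x ^+ 2))).
Proof.
apply: is_derive_eq; rewrite /GRing.scale /=.
by ring.
Qed.

Lemma continuous_expR_sqr : continuous (fun x : R => expR (- (c * x ^+ 2))).
Proof.
move=> x; apply: (@continuous_cvg _ _ _ _ _ _ expR); first exact: continuous_expR.
apply: cvgN; apply: cvgM; first exact: cvg_cst.
exact: exprn_continuous.
Qed.

Lemma continuous_rayleigh_pdf : continuous (rayleigh_pdf c).
Proof.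
(* x + |x| is 2 x for x >= 0 and vanishes otherwise. *)
have -> : rayleigh_pdf c = fun x => c * (x + `|x|) * expR (- (c * x ^+ 2)).
  apply/funext => x; rewrite /rayleigh_pdf; have [x0|x0] := leP 0 x.
    by rewrite ger0_norm //; congr (_ * _); ring.
  by rewrite ltr0_norm // subrr mulr0 mul0r.
move=> x; apply: cvgM.
  apply: cvgM; first exact: cvg_cst.
  by apply: cvgD; [exact: cvg_id|apply: cvg_norm; exact: cvg_id].
exact: continuous_expR_sqr.
Qed.

Lemma measurable_rayleigh_pdf (D : set R) : measurable_fun D (rayleigh_pdf c).
Proof.
apply: measurable_funTS.
by apply: continuous_measurable_fun; exact: continuous_rayleigh_pdf.
Qed.

Lemma primitive_cvg0 : primitive x @[x --> +oo] --> (0 : R).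
Proof.
rewrite -oppr0; apply: cvgN.
apply: (@cvg_comp _ _ _ (fun x => c * x ^+ 2) (fun z => expR (- z)) _ (pinfty_nbhs R)); last exact: cvgr_expR.
apply/cvgryPge => A; near=> x.
have x1 : 1 <= x by near: x; apply: nbhs_pinfty_ge; rewrite num_real.
have xA : A / c <= x by near: x; apply: nbhs_pinfty_ge; rewrite num_real.
rewrite ler_pdivrMr // in xA; apply: le_trans xA _.
by rewrite mulrC ler_pM2l // ler_eXnr.
Unshelve. all: by end_near. Qed.

Lemma rayleigh_tail a : 0 <= a ->
  rayleigh_prob c `]a, +oo[ = (expR (- (c * a ^+ 2)))%:E.
Proof.
move=> a0; rewrite /rayleigh_prob integral_itv_obnd_cbnd; last by apply/measurable_EFinP; exact: measurable_rayleigh_pdf.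
rewrite (@ge0_continuous_FTC2y _ _ primitive _ 0).
- by rewrite /primitive EFinN oppeK add0e.
- by move=> x _; exact: rayleigh_pdf_ge0.
- by apply: continuous_subspaceT; exact: continuous_rayleigh_pdf.
- exact: primitive_cvg0.
- by move=> x _; exact: ex_derive.
- by apply: cvg_at_right_filter; apply: cvgN; exact: continuous_expR_sqr.
- move=> x; rewrite in_itv /= andbT => ax.
  by rewrite derive1E (@derive_val _ _ _ _ _ _ _ (primitive_derive x)) /rayleigh_pdf (le_trans a0 (ltW ax)).
Qed.

Lemma rayleigh_neg : rayleigh_prob c `]-oo, 0] = 0%E.
Proof.
apply: integral0_eq => x /=; rewrite in_itv /= => x0; rewrite /rayleigh_pdf.
case: ifP => // x0'; have -> : x = 0 by apply/eqP; rewrite eq_le x0 x0'.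
by rewrite mulr0 mul0r.
Qed.

Let rayleigh0 : rayleigh_prob c set0 = 0%E.
Proof. by rewrite /rayleigh_prob integral_set0. Qed.

Let rayleigh_ge0 A : (0 <= rayleigh_prob c A)%E.
Proof. by apply: integral_ge0 => x _; rewrite lee_fin rayleigh_pdf_ge0. Qed.

Let rayleigh_sigma_additive : semi_sigma_additive (rayleigh_prob c).
Proof.
move=> /= F mF tF mUF; rewrite /rayleigh_prob; apply: cvg_toP.
  apply: ereal_nondecreasing_is_cvgn => m n mn.
  apply: lee_sum_nneg_natr => // k _ _; apply: integral_ge0 => /= x Fkx.
  by rewrite lee_fin rayleigh_pdf_ge0.
rewrite ge0_integral_bigcup //=.
- by apply/measurable_EFinP; exact: measurable_rayleigh_pdf.
- by move=> x _; rewrite lee_fin rayleigh_pdf_ge0.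
Qed.

HB.instance Definition _ := isMeasure.Build _ _ _
  (rayleigh_prob c) rayleigh0 rayleigh_ge0 rayleigh_sigma_additive.

Lemma rayleigh_setT : rayleigh_prob c [set: R] = 1%E.
Proof.
rewrite -(setUv `]-oo, 0%R]%classic) /rayleigh_prob ge0_integral_setU //=.
- rewrite -!/(rayleigh_prob c _) rayleigh_neg add0e setCitvl rayleigh_tail //.
  by rewrite expr0n mulr0 oppr0 expR0.
- exact: measurableC.
- by apply/measurable_EFinP; exact: measurable_rayleigh_pdf.
- by move=> x _; rewrite lee_fin rayleigh_pdf_ge0.
- exact/disj_setPCl.
Qed.

HB.instance Definition _ := @Measure_isProbability.Build _ _ R
  (rayleigh_prob c) rayleigh_setT.

Definition rayleigh : probability (measurableTypeR R) R := rayleigh_prob c.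

Lemma rayleigh_cdf (x : R) : rayleigh `]-oo, x]%classic =
  (if 0 <= x then 1 - expR (- (c * x ^+ 2)) else 0)%:E.
Proof.
case: ifP => x0.
  have := @probability_setC _ _ R rayleigh `]x, +oo[%classic (measurable_itv _).
  by rewrite setCitvr [X in _ = (_ - X)%E]rayleigh_tail.
apply: integral0_eq => y /=; rewrite in_itv /= => yx; rewrite /rayleigh_pdf.
by rewrite ifF //; apply: contraFF x0 => /le_trans; exact.
Qed.

End Rayleigh.

(** * Passage to the limit *)

Unset Implicit Arguments.
Section Limit.
Variables (R : realType) (d : forall n : nat, 'I_n -> nat) (p2 dbar : R).
Hypothesis d_even : forall n, ~~ odd (degree_sum (d n)).
Hypothesis d_no01 : forall n, num_deg (d n) 0 = 0%N /\ num_deg (d n) 1 = 0%N.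
Hypothesis p2_lim : (num_deg (d n) 2)%:R / n%:R @[n --> \oo] --> p2.
Hypothesis p2_lt1 : p2 < 1.
Hypothesis dbar_lim : mean_D (d n) R @[n --> \oo] --> dbar.

(** All degrees but [2] are at least three, so [dbar >= 3 - p2], and [3 - p2 >
    2 * p2]. *)
Lemma mean_gt : 2 * p2 < dbar.
Proof.
suff : 3 - p2 <= dbar by move: p2_lt1; lra.
apply: (@ler_cvg_to _ \oo _ _ (fun n : nat => 3 - (num_deg (d n) 2)%:R / n%:R) (fun n => mean_D (d n) R)) => //.
  by apply: cvgB => //; exact: cvg_cst.
near=> n; have n0 : (0 < n)%N by near: n; exact: nbhs_infty_gt.
have [e0 e1] := d_no01 n.
rewrite lerBlDr /mean_D -mulrDl ler_pdivlMr ?ltr0n // -natrD -natrM ler_nat.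
exact: degree_sum_ge.
Unshelve. all: by end_near. Qed.

Let q : R := dbar / 2 - p2.
Let q_gt0 : 0 < q. Proof. by rewrite /q; have := mean_gt; lra. Qed.

Lemma kernel_density : (kernel_size (d n))%:R / n%:R @[n --> \oo] --> q.
Proof.
apply: cvg_trans (_ : (mean_D (d n) R / 2 - (num_deg (d n) 2)%:R / n%:R) @[n --> \oo] --> q); last first.
  by apply: cvgB => //; apply: cvgM => //; exact: cvg_cst.
apply: near_eq_cvg; near=> n; have [e0 e1] := d_no01 n.
rewrite /kernel_size natrB ?num_deg2_le // mulrBl; congr (_ - _).
have /(congr1 (fun k => k%:R : R)) := even_halfK (d_even n).
by rewrite -muln2 natrM /mean_D => <-; rewrite -/(num_edges _) mulrAC mulfK.
Unshelve. all: by end_near. Qed.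

Lemma kernel_size_cvg : ((kernel_size (d n))%:R : R) @[n --> \oo] --> +oo.
Proof.
apply/cvgryPge => A; have q2 : q / 2 < q by move: q_gt0; lra.
near=> n.
have n0 : (0 < n)%N by near: n; exact: nbhs_infty_gt.
have h : q / 2 < (kernel_size (d n))%:R / n%:R by near: n; exact: cvgr_gt kernel_density _ q2.
have hA : A / (q / 2) <= n%:R by near: n; exact: nbhs_infty_ger.
move: h; rewrite ltr_pdivlMr ?ltr0n // => /ltW; apply: le_trans.
by rewrite mulrC -ler_pdivrMr // divr_gt0.
Unshelve. all: by end_near. Qed.

Lemma subdivision_ratio_cvg :
  (num_edges (d n) - kernel_size (d n))%:R / (kernel_size (d n))%:R @[n --> \oo] --> p2 / q.
Proof.
apply: cvg_trans (_ : ((num_deg (d n) 2)%:R / n%:R) / ((kernel_size (d n))%:R / n%:R) @[n --> \oo] --> p2 / q); last first.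
  by apply: cvgM => //; apply: cvgV; [rewrite gt_eqF|exact: kernel_density].
apply: near_eq_cvg; near=> n; have [e0 e1] := d_no01 n.
have n0 : (0 < n)%N by near: n; exact: nbhs_infty_gt.
have k0 : 0 < (kernel_size (d n))%:R :> R.
  by near: n; move/cvgryPgt : kernel_size_cvg; exact.
rewrite {1}/kernel_size subKn ?num_deg2_le //.
by field; rewrite gt_eqF // pnatr_eq0 -lt0n n0.
Unshelve. all: by end_near. Qed.

(** Squeezes the survival probability between the bounds of [prob_T_bounds],
    whose error vanishes by [kernel_survival]. *)
Lemma prob_T_cvg (x : R) : 0 <= x ->
  prob_T (d n) R (fun t => t <= Num.truncn (x * Num.sqrt (num_edges (d n))%:R))%N @[n --> \oo]
  --> 1 - expR (- (x ^+ 2 * (p2 / q))).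
Proof.
move=> x0; set b := p2 / q.
pose m n := num_edges (d n); pose m' n := kernel_size (d n).
pose k n := Num.truncn (x * Num.sqrt (m n)%:R).
have mm : \forall n \near \oo, (m' n <= m n)%N by near=> n; exact: leq_subr.
have [t0 Qcvg] := @no_repeat_prob_cvg R m m' b x x0 mm kernel_size_cvg subdivision_ratio_cvg.
have m'pos : \forall n \near \oo, 0 < (m' n)%:R :> R.
  by move/cvgryPgt : kernel_size_cvg; exact.
have [K K0 Kbound] := @kernel_survival R (x * Num.sqrt (b + 2)) (mulr_ge0 x0 (sqrtr_ge0 _)).
pose mu n : R := if (0 < m' n)%N then (m' n)%:R^-1 `^ 6^-1 else 0.
have mu6 n : (0 < m' n)%N -> 0 < mu n /\ mu n ^+ 6 = (m' n)%:R^-1.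
  move=> h; rewrite /mu h; have i0 : 0 < (m' n)%:R^-1 :> R by rewrite invr_gt0 ltr0n.
  by split; [exact: powR_gt0|exact: powR_root6].
have mu_cvg : mu n @[n --> \oo] --> (0 : R).
  have inv0 : (m' n)%:R^-1 @[n --> \oo] --> (0 : R) by apply/gtr0_cvgV0 => //; exact: kernel_size_cvg.
  apply/cvgr0Pnorm_le => e e0; near=> n.
  have h : (0 < m' n)%N by rewrite -(ltr0n R); near: n.
  have [mu0 E] := mu6 n h; rewrite gtr0_norm //.
  rewrite -(@ler_pXn2r _ 6) ?nnegrE ?(ltW mu0) ?(ltW e0) // E.
  by near: n; exact: cvgr_le inv0 _ (exprn_gt0 6 e0).
have Kmu : K * mu n @[n --> \oo] --> (0 : R).
  by rewrite -(mulr0 K); apply: cvgM => //; exact: cvg_cst.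
have mid : 1 - prob_T (d n) R (fun t => t <= k n)%N @[n --> \oo] --> expR (- (x ^+ 2 * b)).
  apply: (@squeeze_cvgr _ _ _ _ (fun n => (1 - K * mu n) * no_repeat_prob R (m n) (m' n) (k n))
     (fun n => no_repeat_prob R (m n) (m' n) (k n))) => //; last first.
    rewrite -[X in _ --> X]mul1r -[X in X * _]subr0; apply: cvgM => //.
    by apply: cvgB => //; exact: cvg_cst.
  (* [b + 2] bounds the ratio [m n / m' n], which tends to [b + 1]; it turns the
     bound on [k n] in terms of [m n] into one in terms of the kernel. *)
  have b_lt : b < b + 1 by rewrite ltrDl.
  near=> n.
  have m0R : 0 < (m' n)%:R :> R by near: n.
  have m0 : (0 < m' n)%N by rewrite -(ltr0n R).
  have [mu0 E] := mu6 n m0.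
  have [e0 e1] := d_no01 n.
  have km : (k n < m' n)%N.
    have : (k n)%:R / (m' n)%:R < 1 :> R by near: n; exact: cvgr_lt t0 _ ltr01.
    by rewrite ltr_pdivrMr // mul1r ltr_nat.
  have mb : (m n)%:R <= (b + 2) * (m' n)%:R :> R.
    have : (m n - m' n)%:R / (m' n)%:R < b + 1 :> R.
      by near: n; exact: cvgr_lt subdivision_ratio_cvg _ b_lt.
    by rewrite ltr_pdivrMr // natrB ?leq_subr //; lra.
  have b20 : 0 <= b + 2.
    rewrite -(pmulr_lge0 _ m0R); apply: le_trans mb; exact: ler0n.
  have kc : (k n)%:R <= x * Num.sqrt (b + 2) * Num.sqrt (m' n)%:R.
    rewrite -mulrA -sqrtrM //; apply: (@le_trans _ _ (x * Num.sqrt (m n)%:R)).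
      by rewrite truncn_le mulr_ge0 ?sqrtr_ge0.
    by rewrite ler_wpM2l // ler_wsqrtr.
  apply: prob_T_bounds => //.
  - by rewrite mulr_ge0 // ltW.
  - by near: n; exact: cvgr_lt Kmu _ ltr01.
  - exact: ltnW.
  move=> j jk; apply: Kbound => //.
  - by move=> v; rewrite inE degreeE.
  - exact: card_kernel_halves.
  - by case/orP: jk => /eqP -> //; exact: ltnW.
  - case/orP: jk => /eqP -> //; by rewrite !mulr_ge0 ?sqrtr_ge0.
have -> : (fun n => prob_T (d n) R (fun t => t <= k n)%N) = (fun n => 1 - (1 - prob_T (d n) R (fun t => t <= k n)%N)).
  by apply/funext => n; rewrite subKr.
by apply: cvgB => //; exact: cvg_cst.
Unshelve. all: by end_near. Qed.

End Limit.

Theorem theorem2p1 (R : realType) (d : forall n : nat, 'I_n -> nat)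
  (disp : measure_display) (Omega : measurableType disp)
  (P : probability Omega R) (D : {RV P >-> measurableTypeR R})
  (p2 dbar eps : R)
  (d_even : forall n, ~~ odd (degree_sum (d n)))
  (D_lim : cvg_in_distribution
    (fun n x => prob_D (d n) R (fun k => k%:R <= x)) (distribution P D))
  (d_no01 : forall n, num_deg (d n) 0 = 0%N /\ num_deg (d n) 1 = 0%N)
  (p2_lim : (num_deg (d n) 2)%:R / n%:R @[n --> \oo] --> p2)
  (p2_gt0 : 0 < p2) (p2_lt1 : p2 < 1)
  (eps_gt0 : 0 < eps)
  (d_max : \forall n \near \oo, forall j : nat,
    n%:R `^ (4^-1 - eps) <= j%:R :> R -> num_deg (d n) j = 0%N)
  (dbar_lim : mean_D (d n) R @[n --> \oo] --> dbar) :
  exists TD : probability (measurableTypeR R) R,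
    has_density TD (fun x =>
      if 0 <= x
      then 4 * p2 * x / (dbar - 2 * p2)
           * expR (- (2 * x ^+ 2 * p2 / (dbar - 2 * p2)))
      else 0)
    /\ cvg_in_distribution
         (fun n x => prob_T (d n) R (fun t =>
            (Num.sqrt (num_edges (d n))%:R)^-1 * t%:R <= x)) TD.
Proof.
have gap : 0 < dbar - 2 * p2 by rewrite subr_gt0; exact: mean_gt d_no01 p2_lim p2_lt1 dbar_lim.
pose c := 2 * p2 / (dbar - 2 * p2).
have c_gt0 : 0 < c by rewrite divr_gt0 // mulr_gt0.
exists (rayleigh c_gt0); split.
  move=> A mA; apply: eq_integral => x _; congr EFin; rewrite /rayleigh_pdf /c.
  case: ifP => // _; congr (_ * expR (- _)); field; rewrite gt_eqF //.
move=> x _; rewrite rayleigh_cdf; apply: cvg_EFin; first by near=> n.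
case: ifP => [x0|/negbT]; last first.
  rewrite -ltNge => x0; apply: cvg_near_cst; near=> n => /=; rewrite /prob_T big1 // => M _.
  rewrite big1 ?mul0r ?mulr0 // => s _.
  rewrite [X in (nat_of_bool X)%:R](_ : _ = false) //; apply/negbTE; rewrite -ltNge.
  by apply: lt_le_trans x0 _; rewrite mulr_ge0 // invr_ge0 sqrtr_ge0.
have -> : c * x ^+ 2 = x ^+ 2 * (p2 / (dbar / 2 - p2)).
  rewrite /c; field; rewrite !gt_eqF //; lra.
apply: cvg_trans (prob_T_cvg _ _ _ _ d_even d_no01 p2_lim p2_lt1 dbar_lim _ x0).
apply: near_eq_cvg; near=> n => /=.
have m0 : 0 < (num_edges (d n))%:R :> R.
  have : 0 < (kernel_size (d n))%:R :> R.
    by near: n; move/cvgryPgt : (kernel_size_cvg _ _ _ _ d_even d_no01 p2_lim p2_lt1 dbar_lim); exact.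
  by rewrite !ltr0n => /leq_trans; apply; exact: leq_subr.
rewrite /prob_T; apply: eq_bigr => M _; congr (_ * (_ / _)); apply: eq_bigr => s _; congr (nat_of_bool _)%:R.
have s0 : 0 < Num.sqrt (num_edges (d n))%:R :> R by rewrite sqrtr_gt0.
have y0 : 0 <= x * Num.sqrt (num_edges (d n))%:R by rewrite mulr_ge0 // ltW.
rewrite [_^-1 * _]mulrC ler_pdivrMr //.
have /andP[t1 t2] := truncn_itv y0.
apply/idP/idP => h; first by apply: le_trans t1; rewrite ler_nat.
by rewrite -ltnS -(ltr_nat R); apply: le_lt_trans h t2.
Unshelve. all: by end_near. Qed.
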